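(* Let $R$ be a commutative noetherian ring, let $n\ge1$, and let $S$ be the ring $R^{\oplus n}$ (with the diagonal map $R\to S$). Then $\Pi_R(S)$ is isomorphic to the preprojective algebra over $R$ associated to the quiver with one central vertex and $n$ outgoing arrows (from the central vertex to $n$ distinct outer vertices).
   Context: Relative Frobenius pairs: let $R\to S$ be a morphism of commutative rings. $S/R$ is relative Frobenius of rank $n$ if $S$ is a free $R$-module of rank $n$ and $\operatorname{Hom}_R(S,R)\cong S$ as $S$-modules. Generalized preprojective algebra: given such a pair, let $R\oplus S$ be the product ring. Let $M={}_RS_S$, viewed as an $R\oplus S$-bimodule with $R$ acting on the left, $S$ acting on the right and the other components acting by zero. Let $N={}_SS_R$, viewed as an $R\oplus S$-bimodule with $S$ acting on the left, $R$ acting on the right and the other components acting by zero. Put $T(R,S)=T_{R\oplus S}(M\oplus N)$ (tensor algebra over $R\oplus S$, graded by tensor degree). Then $M\otimes_{R\oplus S}M=N\otimes_{R\oplus S}N=0$, $M\otimes_{R\oplus S}N=S\otimes_SS$ (an $R$-$R$-bimodule) and $N\otimes_{R\oplus S}M=S\otimes_RS$ (an $S$-$S$-bimodule). Let $\lambda$ be a generator of $\operatorname{Hom}_R(S,R)$ as an $S$-module and let $(e_i)_i,(f_j)_j$ be $R$-bases of $S$ with $\lambda(e_if_j)=\delta_{ij}$. Then $\Pi_R(S)=T(R,S)/I$, where $I$ is the two-sided ideal generated by the degree $2$ elements $1\otimes 1\in M\otimes_{R\oplus S}N$ and $\sum_ie_i\otimes f_i\in N\otimes_{R\oplus S}M$.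 It is an $\mathbb{N}$-graded $R$-algebra (via $r\mapsto(r,r\cdot1_S)\in R\oplus S$), independent of the choices up to isomorphism. Preprojective algebra: for the star quiver $Q$ with arrows $a_1,\dots,a_n$ from the central vertex to the outer vertices, let $\overline Q$ be the doubled quiver, obtained by adding an arrow $a_i^*$ in the direction opposite to $a_i$ for each $i$. The preprojective algebra of $Q$ over $R$ is the path algebra $R\overline Q$ modulo the two-sided ideal generated by the two elements $\sum_ia_ia_i^*$ and $\sum_ia_i^*a_i$. *)

(* Defs.v *)
From HB Require Import structures.
From mathcomp Require Import all_boot all_order all_algebra.
From mathcomp Require Import finmap boolp.
From mathcomp Require Import monalg.

Set Implicit Arguments.
Unset Strict Implicit.
Unset Printing Implicit Defensive.

Import GRing.Theory.

Local Open Scope ring_scope.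
Local Open Scope quotient_scope.

Record two_sided_ideal (A : pzRingType) (I : A -> Prop) : Prop := {
  ideal0 : I 0;
  idealB : forall x y, I x -> I y -> I (x - y);
  idealMl : forall a x, I x -> I (a * x);
  idealMr : forall a x, I x -> I (x * a)
}.

Inductive ideal_gen (A : pzRingType) (G : A -> Prop) : A -> Prop :=
| ideal_gen_in x : G x -> ideal_gen G x
| ideal_gen0 : ideal_gen G 0
| ideal_genB x y : ideal_gen G x -> ideal_gen G y -> ideal_gen G (x - y)
| ideal_genMl a x : ideal_gen G x -> ideal_gen G (a * x)
| ideal_genMr a x : ideal_gen G x -> ideal_gen G (x * a).

Definition noetherian (R : comPzRingType) : Prop :=
  forall I : R -> Prop, two_sided_ideal I ->
  exists s : seq R, forall x, I x <-> ideal_gen (fun y => y \in s) x.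

Section RingQuotient.
Variables (A : pzRingType) (G : A -> Prop).

Definition idealb : {pred A} := fun x => `[< ideal_gen G x >].

Fact idealb_zmod_closed : zmod_closed idealb.
Proof.
split; first by apply/asboolP; apply: ideal_gen0.
by move=> x y /asboolP Ix /asboolP Iy; apply/asboolP; apply: ideal_genB.
Qed.

HB.instance Definition _ := GRing.isZmodClosed.Build A idealb idealb_zmod_closed.

(* The carrier is mathcomp's quotient of A by the additive subgroup idealb;
   its library ring structure is for commutative rings only. *)
Definition ringquot : Type := Quotient.quot idealb.

HB.instance Definition _ := GRing.Zmodule.on ringquot.

Definition rq_pi (x : A) : ringquot := \pi_(Quotient.quot idealb) x.

Lemma rq_piP (P : ringquot -> Prop) : (forall x, P (rq_pi x)) -> forall q, P q.
Proof. by move=> Ppi q; rewrite -[q]reprK; apply: Ppi. Qed.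

Lemma rq_pi_eq x y : rq_pi x = rq_pi y <-> ideal_gen G (x - y).
Proof.
split=> [/eqP|xy].
  by rewrite -(Quotient.idealrBE idealb) => /asboolP.
by apply/eqP; rewrite -(Quotient.idealrBE idealb); apply/asboolP.
Qed.

Fact rq_pi_zmod_morphism : zmod_morphism rq_pi.
Proof. exact: raddfB. Qed.

HB.instance Definition _ :=
  GRing.isZmodMorphism.Build A ringquot rq_pi rq_pi_zmod_morphism.

Definition rq_mul (p q : ringquot) : ringquot := rq_pi (repr p * repr q).

Lemma rq_pi_repr (q : ringquot) : rq_pi (repr q) = q.
Proof. exact: reprK. Qed.

Lemma rq_mulE x y : rq_mul (rq_pi x) (rq_pi y) = rq_pi (x * y).
Proof.
apply/rq_pi_eq; set x' := repr _; set y' := repr _.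
have Ix : ideal_gen G (x' - x) by apply/rq_pi_eq; rewrite rq_pi_repr.
have Iy : ideal_gen G (y' - y) by apply/rq_pi_eq; rewrite rq_pi_repr.
have -> : x' * y' - x * y = x' * (y' - y) - ((- (x' - x)) * y).
  by rewrite mulrBr mulNr opprK mulrBl addrA subrK.
apply: ideal_genB; first exact: ideal_genMl.
by rewrite -sub0r; apply: ideal_genMr; apply: ideal_genB => //; apply: ideal_gen0.
Qed.

Fact rq_mulA : associative rq_mul.
Proof.
by elim/rq_piP=> x; elim/rq_piP=> y; elim/rq_piP=> z; rewrite !rq_mulE mulrA.
Qed.

Fact rq_mul1 : left_id (rq_pi 1) rq_mul.
Proof. by elim/rq_piP=> x; rewrite rq_mulE mul1r. Qed.

Fact rq_mulr1 : right_id (rq_pi 1) rq_mul.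
Proof. by elim/rq_piP=> x; rewrite rq_mulE mulr1. Qed.

Fact rq_mulDl : left_distributive rq_mul +%R.
Proof.
elim/rq_piP=> x; elim/rq_piP=> y; elim/rq_piP=> z.
by rewrite -raddfD !rq_mulE -raddfD mulrDl.
Qed.

Fact rq_mulDr : right_distributive rq_mul +%R.
Proof.
elim/rq_piP=> x; elim/rq_piP=> y; elim/rq_piP=> z.
by rewrite -raddfD !rq_mulE -raddfD mulrDr.
Qed.

HB.instance Definition _ := GRing.Zmodule_isPzRing.Build ringquot
  rq_mulA rq_mul1 rq_mulr1 rq_mulDl rq_mulDr.

Fact rq_pi_monoid_morphism : monoid_morphism rq_pi.
Proof. by split=> // x y; rewrite -rq_mulE. Qed.

HB.instance Definition _ :=
  GRing.isMonoidMorphism.Build A ringquot rq_pi rq_pi_monoid_morphism.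

End RingQuotient.

HB.mixin Record isBimodule (A B : pzRingType) M of GRing.Lmodule A M := {
  ract : M -> B -> M;
  ractDl : forall b, {morph ract^~ b : x y / x + y};
  ractDr : forall x, {morph ract x : b c / b + c};
  ractM : forall x b c, ract x (b * c) = ract (ract x b) c;
  ract1 : forall x, ract x 1 = x;
  ract_scale : forall a x b, ract (a *: x) b = a *: ract x b
}.

#[short(type="bimodType")]
HB.structure Definition Bimodule (A B : pzRingType) :=
  {M of isBimodule A B M & GRing.Lmodule A M}.

Section PairBimodule.
Variables (A B : pzRingType) (M N : bimodType A B).

Definition pair_ract (x : M * N) (b : B) : M * N := (ract x.1 b, ract x.2 b).

Fact pair_ractDl b : {morph pair_ract^~ b : x y / x + y}.
Proof. by move=> x y; rewrite /pair_ract !ractDl. Qed.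
Fact pair_ractDr x : {morph pair_ract x : b c / b + c}.
Proof. by move=> b c; rewrite /pair_ract !ractDr. Qed.
Fact pair_ractM x b c : pair_ract x (b * c) = pair_ract (pair_ract x b) c.
Proof. by rewrite /pair_ract !ractM. Qed.
Fact pair_ract1 x : pair_ract x 1 = x.
Proof. by case: x => x y; rewrite /pair_ract !ract1. Qed.
Fact pair_ract_scale a x b : pair_ract (a *: x) b = a *: pair_ract x b.
Proof. by rewrite /pair_ract !ract_scale. Qed.

HB.instance Definition _ := isBimodule.Build A B (M * N)%type
  pair_ractDl pair_ractDr pair_ractM pair_ract1 pair_ract_scale.

End PairBimodule.

Section FreeLift.
Variables (K : choiceType) (W : zmodType) (h : K -> W).

Definition free_lift (g : {malg int[K]}) : W :=
  \sum_(k <- msupp g) h k *~ g@_k.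

Lemma free_liftw (d : {fset K}) g : (msupp g `<=` d)%fset ->
  free_lift g = \sum_(k <- d) h k *~ g@_k.
Proof.
move=> le; rewrite /free_lift (big_fset_incl _ le) // => k _ /mcoeff_outdom ->.
by rewrite mulr0z.
Qed.

Fact free_lift_zmod_morphism : zmod_morphism free_lift.
Proof.
move=> x y.
rewrite (free_liftw (fsubsetUl (msupp x) (msupp y))).
rewrite (free_liftw (fsubsetUr (msupp x) (msupp y))).
rewrite (free_liftw (msuppB_le x y)) -sumrB.
by apply: eq_bigr => k _; rewrite mcoeffB mulrzBr.
Qed.

HB.instance Definition _ := GRing.isZmodMorphism.Build _ _ free_lift
  free_lift_zmod_morphism.

Lemma free_liftU k : free_lift << k >> = h k.
Proof. by rewrite (free_liftw msuppU_le) big_seq_fset1 mcoeffUU. Qed.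

End FreeLift.

Section Tensor.
Variables (A B : pzRingType) (M : bimodType A B) (N : lmodType B).

Local Notation F := {malg int[(M * N)%type]}.

Inductive tens_rel : F -> Prop :=
| tens_relDl m1 m2 n :
    tens_rel (<< (m1 + m2, n) >> - << (m1, n) >> - << (m2, n) >>)
| tens_relDr m n1 n2 :
    tens_rel (<< (m, n1 + n2) >> - << (m, n1) >> - << (m, n2) >>)
| tens_relM m b n : tens_rel (<< (ract m b, n) >> - << (m, b *: n) >>)
| tens_rel0 : tens_rel 0
| tens_relB x y : tens_rel x -> tens_rel y -> tens_rel (x - y).

Definition tens_relb : {pred F} := fun x => `[< tens_rel x >].

Fact tens_relb_zmod_closed : zmod_closed tens_relb.
Proof.
split; first by apply/asboolP; apply: tens_rel0.
by move=> x y /asboolP Ix /asboolP Iy; apply/asboolP; apply: tens_relB.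
Qed.

HB.instance Definition _ := GRing.isZmodClosed.Build F tens_relb
  tens_relb_zmod_closed.

(* M (x)_B N, the free abelian group on M x N modulo tens_rel; only its left
   A-module structure is recorded. *)
Definition tens : Type := Quotient.quot tens_relb.

HB.instance Definition _ := GRing.Zmodule.on tens.

Definition tens_pi (x : F) : tens := \pi_(Quotient.quot tens_relb) x.

Fact tens_pi_zmod_morphism : zmod_morphism tens_pi.
Proof. exact: raddfB. Qed.

HB.instance Definition _ :=
  GRing.isZmodMorphism.Build F tens tens_pi tens_pi_zmod_morphism.

Lemma tens_pi_eq x y : tens_pi x = tens_pi y <-> tens_rel (x - y).
Proof.
split=> [/eqP|xy].
  by rewrite -(Quotient.idealrBE tens_relb) => /asboolP.
by apply/eqP; rewrite -(Quotient.idealrBE tens_relb); apply/asboolP.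
Qed.

Lemma tens_pi0 x : tens_rel x -> tens_pi x = 0.
Proof. by move=> rx; rewrite -(raddf0 tens_pi); apply/tens_pi_eq; rewrite subr0. Qed.

Definition tensor (m : M) (n : N) : tens := tens_pi << (m, n) >>.

Lemma tensorDl n : {morph tensor^~ n : x y / x + y}.
Proof.
move=> x y; apply/eqP; rewrite -subr_eq0 opprD addrA -!raddfB.
by apply/eqP/tens_pi0/tens_relDl.
Qed.

Lemma tensorDr m : {morph tensor m : x y / x + y}.
Proof.
move=> x y; apply/eqP; rewrite -subr_eq0 opprD addrA -!raddfB.
by apply/eqP/tens_pi0/tens_relDr.
Qed.

Lemma tensorM m b n : tensor (ract m b) n = tensor m (b *: n).
Proof.
by apply/eqP; rewrite -subr_eq0 -!raddfB; apply/eqP/tens_pi0/tens_relM.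
Qed.

Record balanced (W : zmodType) (h : M -> N -> W) : Prop := {
  balancedDl : forall n, {morph h^~ n : x y / x + y};
  balancedDr : forall m, {morph h m : x y / x + y};
  balancedM : forall m b n, h (ract m b) n = h m (b *: n)
}.

Definition tens_lift (W : zmodType) (h : M -> N -> W) (x : tens) : W :=
  free_lift (fun p : (M * N)%type => h p.1 p.2) (repr x).

Lemma tens_lift_pi (W : zmodType) (h : M -> N -> W) x : balanced h ->
  tens_lift h (tens_pi x) = free_lift (fun p : (M * N)%type => h p.1 p.2) x.
Proof.
move=> hh; rewrite /tens_lift.
have: tens_rel (repr (tens_pi x) - x) by apply/tens_pi_eq; apply: reprK.
move: (repr _) => y; move E: (y - x) => z rz.
apply/eqP; rewrite -subr_eq0 -raddfB E; apply/eqP.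
elim: {y x E} rz => [m1 m2 n|m n1 n2|m b n| |x y _ IHx _ IHy].
- by rewrite !raddfB /= !free_liftU /= (balancedDl hh) -addrA -opprD subrr.
- by rewrite !raddfB /= !free_liftU /= (balancedDr hh) -addrA -opprD subrr.
- by rewrite !raddfB /= !free_liftU /= (balancedM hh) subrr.
- by rewrite raddf0.
- by rewrite raddfB /= IHx IHy subrr.
Qed.

Lemma tens_liftE (W : zmodType) (h : M -> N -> W) m n : balanced h ->
  tens_lift h (tensor m n) = h m n.
Proof. by move=> hh; rewrite tens_lift_pi // free_liftU. Qed.

Lemma tens_piP (P : tens -> Prop) : (forall x, P (tens_pi x)) -> forall q, P q.
Proof. by move=> Ppi q; rewrite -[q]reprK; apply: Ppi. Qed.

Lemma tens_liftB (W : zmodType) (h : M -> N -> W) : balanced h ->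
  zmod_morphism (tens_lift h).
Proof.
move=> hh; elim/tens_piP=> x; elim/tens_piP=> y.
by rewrite -raddfB !tens_lift_pi // raddfB.
Qed.

Lemma tens_lift0 (W : zmodType) (h : M -> N -> W) : balanced h ->
  tens_lift h 0 = 0.
Proof. by move=> hh; have := tens_liftB hh 0 0; rewrite !subrr. Qed.

Lemma tens_liftD (W : zmodType) (h : M -> N -> W) : balanced h ->
  {morph tens_lift h : x y / x + y}.
Proof.
move=> hh x y; rewrite -[y in LHS]opprK tens_liftB // -[- y]sub0r tens_liftB //.
by rewrite tens_lift0 // sub0r opprK.
Qed.

Lemma tensor0l n : tensor 0 n = 0.
Proof. by apply: (addrI (tensor 0 n)); rewrite -tensorDl !addr0. Qed.

Lemma tensorNl m n : tensor (- m) n = - tensor m n.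
Proof. by apply/eqP; rewrite -addr_eq0 -tensorDl addNr tensor0l. Qed.

Lemma tensor_ind (P : tens -> Prop) : P 0 ->
  (forall m n, P (tensor m n)) -> (forall x y, P x -> P y -> P (x + y)) ->
  forall x, P x.
Proof.
move=> P0 Pt PD; elim/tens_piP=> x; rewrite [x]monalgE raddf_sum /=.
elim/big_rec: _ => // -[m n] y _ Py; apply: (PD) => //; move: (x@_ _) => z.
have Pn k m' : P (tensor m' n *+ k).
  by elim: k => [|k IHk] //; rewrite mulrS; apply: (PD).
have E k : tens_pi << k%:R *g (m, n) >> = tensor m n *+ k.
  by rewrite monalgUMn raddfMn.
case: z => k; first by rewrite -(natz k) E.
by rewrite NegzE monalgUN raddfN -(natz k.+1) /= E -mulNrn -tensorNl.
Qed.

Definition tens_scale (a : A) (x : tens) : tens :=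
  tens_lift (fun m n => tensor (a *: m) n) x.

Fact tens_scale_balanced a : balanced (fun m n => tensor (a *: m) n).
Proof.
split=> [n x y|m x y|m b n]; first by rewrite scalerDr tensorDl.
- by rewrite tensorDr.
- by rewrite -ract_scale tensorM.
Qed.

Lemma tens_scaleE a m n : tens_scale a (tensor m n) = tensor (a *: m) n.
Proof. exact/tens_liftE/tens_scale_balanced. Qed.

Fact tens_scaleDr : right_distributive tens_scale +%R.
Proof. by move=> a; apply/tens_liftD/tens_scale_balanced. Qed.

Fact tens_scale0 a : tens_scale a 0 = 0.
Proof. exact/tens_lift0/tens_scale_balanced. Qed.

Fact tens_scaleA a b x : tens_scale a (tens_scale b x) = tens_scale (a * b) x.
Proof.
elim/tensor_ind: x => [|m n|x y Hx Hy]; first by rewrite !tens_scale0.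
  by rewrite !tens_scaleE scalerA.
by rewrite !tens_scaleDr Hx Hy.
Qed.

Fact tens_scale1 : left_id 1 tens_scale.
Proof.
elim/tensor_ind => [|m n|x y Hx Hy]; first by rewrite !tens_scale0.
  by rewrite !tens_scaleE scale1r.
by rewrite !tens_scaleDr Hx Hy.
Qed.

Fact tens_scaleDl x : {morph tens_scale^~ x : a b / a + b}.
Proof.
move=> a b; elim/tensor_ind: x => [|m n|x y Hx Hy].
- by rewrite !tens_scale0 addr0.
- by rewrite !tens_scaleE scalerDl tensorDl.
- by rewrite !tens_scaleDr Hx Hy addrACA.
Qed.

HB.instance Definition _ := GRing.Zmodule_isLmodule.Build A tens
  tens_scaleA tens_scale1 tens_scaleDr tens_scaleDl.

Lemma tensor_scale a m n : a *: tensor m n = tensor (a *: m) n.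
Proof. exact: tens_scaleE. Qed.

End Tensor.

Section DirectSum.
Variables (A : pzRingType) (T : nat -> lmodType A).

Record dsum : Type := Dsum {
  dval :> forall k, T k;
  dval_fin : exists N, forall k, (N <= k)%N -> dval k = 0
}.

HB.instance Definition _ := gen_eqMixin dsum.
HB.instance Definition _ := gen_choiceMixin dsum.

Lemma dsumP (x y : dsum) : (forall k, x k = y k) -> x = y.
Proof.
case: x y => [x xP] [y yP] /= xy.
have e : x = y by apply: functional_extensionality_dep.
by case: _ / e yP => yP; congr Dsum; apply: Prop_irrelevance.
Qed.

Fact dsum_zero_fin : exists N, forall k, (N <= k)%N -> (0 : T k) = 0.
Proof. by exists 0. Qed.
Definition dsum_zero := Dsum dsum_zero_fin.

Fact dsum_opp_fin (x : dsum) :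
  exists N, forall k, (N <= k)%N -> - x k = 0.
Proof. by case: x => x [N xN]; exists N => k /xN /= ->; rewrite oppr0. Qed.
Definition dsum_opp x := Dsum (dsum_opp_fin x).

Fact dsum_add_fin (x y : dsum) :
  exists N, forall k, (N <= k)%N -> x k + y k = 0.
Proof.
case: x y => x [N xN] [y [M yM]]; exists (maxn N M) => k /=.
by rewrite geq_max => /andP[/xN-> /yM->]; rewrite addr0.
Qed.
Definition dsum_add x y := Dsum (dsum_add_fin x y).

Fact dsum_addA : associative dsum_add.
Proof. by move=> x y z; apply: dsumP => k /=; rewrite addrA. Qed.
Fact dsum_addC : commutative dsum_add.
Proof. by move=> x y; apply: dsumP => k /=; rewrite addrC. Qed.
Fact dsum_add0 : left_id dsum_zero dsum_add.
Proof. by move=> x; apply: dsumP => k /=; rewrite add0r. Qed.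
Fact dsum_addN : left_inverse dsum_zero dsum_opp dsum_add.
Proof. by move=> x; apply: dsumP => k /=; rewrite addNr. Qed.

HB.instance Definition _ := GRing.isZmodule.Build dsum
  dsum_addA dsum_addC dsum_add0 dsum_addN.

Fact dsum_scale_fin (a : A) (x : dsum) :
  exists N, forall k, (N <= k)%N -> a *: x k = 0.
Proof. by case: x => x [N xN]; exists N => k /xN /= ->; rewrite scaler0. Qed.
Definition dsum_scale a x := Dsum (dsum_scale_fin a x).

Fact dsum_scaleA a b x : dsum_scale a (dsum_scale b x) = dsum_scale (a * b) x.
Proof. by apply: dsumP => k /=; rewrite scalerA. Qed.
Fact dsum_scale1 : left_id 1 dsum_scale.
Proof. by move=> x; apply: dsumP => k /=; rewrite scale1r. Qed.
Fact dsum_scaleDr : right_distributive dsum_scale +%R.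
Proof. by move=> a x y; apply: dsumP => k /=; rewrite scalerDr. Qed.
Fact dsum_scaleDl x : {morph dsum_scale^~ x : a b / a + b}.
Proof. by move=> a b; apply: dsumP => k /=; rewrite scalerDl. Qed.

HB.instance Definition _ := GRing.Zmodule_isLmodule.Build A dsum
  dsum_scaleA dsum_scale1 dsum_scaleDr dsum_scaleDl.

Lemma dvalD (x y : dsum) k : (x + y) k = x k + y k. Proof. by []. Qed.
Lemma dval0 k : (0 : dsum) k = 0. Proof. by []. Qed.
Lemma dvalZ a (x : dsum) k : (a *: x) k = a *: x k. Proof. by []. Qed.

Lemma dval_sum I (r : seq I) (P : pred I) (F : I -> dsum) k :
  (\sum_(i <- r | P i) F i) k = \sum_(i <- r | P i) F i k.
Proof. exact: (big_morph (fun x : dsum => x k) (fun x y => dvalD x y k)). Qed.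

Definition dbound (x : dsum) : nat := projT1 (cid (dval_fin x)).

Lemma dboundP x k : (dbound x <= k)%N -> x k = 0.
Proof. by rewrite /dbound; case: cid => N /= xN; apply: xN. Qed.

Definition dincl (i : nat) (t : T i) (k : nat) : T k :=
  if @eqP _ i k is ReflectT e then ecast j (T j) e t else 0.

Fact dincl_fin i (t : T i) :
  exists N, forall k, (N <= k)%N -> dincl t k = 0.
Proof.
exists i.+1 => k; rewrite /dincl; case: eqP => // e.
by rewrite -[in X in (X -> _)]e ltnn.
Qed.
Definition dsum_in i (t : T i) : dsum := Dsum (dincl_fin t).

Lemma dsum_in_eq i (t : T i) : dsum_in t i = t.
Proof.
rewrite /= /dincl; case: eqP => // e.
by rewrite [e](eq_irrelevance e (erefl i)).
Qed.

Lemma dsum_in_neq i (t : T i) k : i != k -> dsum_in t k = 0.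
Proof. by move=> ik; rewrite /= /dincl; case: eqP => // e; rewrite e eqxx in ik. Qed.

Lemma dsum_decomp (x : dsum) N : (dbound x <= N)%N ->
  x = \sum_(i < N) dsum_in (x i).
Proof.
move=> bN; apply: dsumP => k; rewrite dval_sum.
have [kN|Nk] := ltnP k N; last first.
  rewrite dboundP ?(leq_trans bN) // big1 // => i _.
  by rewrite dsum_in_neq // neq_ltn (leq_trans (ltn_ord i)).
rewrite (bigD1 (Ordinal kN)) //= big1 ?addr0 => [|i].
  exact/esym/dsum_in_eq.
rewrite -val_eqE => /= ik; exact: dsum_in_neq.
Qed.

End DirectSum.

Section TensorAlgebra.
Variables (A : pzRingType) (V : bimodType A A).

(* V^{(x) k}, bracketed as V (x) (V (x) ... (x) (V (x) A)): only the left
   action of the right-hand factor is needed to form the next power. *)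
Fixpoint tpow (k : nat) : lmodType A :=
  if k is k'.+1 then tens V (tpow k') else A^o.

Definition tensalg : Type := dsum tpow.

HB.instance Definition _ := GRing.Lmodule.on tensalg.

Implicit Types (v : V) (x y z : tensalg).

Definition tcons_val v x (k : nat) : tpow k :=
  match k return tpow k with
  | 0 => 0
  | k'.+1 => tensor v (dval x k')
  end.

Lemma tensor0r (B C : pzRingType) (M : bimodType B C) (N : lmodType C) (m : M) :
  tensor m (0 : N) = 0.
Proof. by apply: (addrI (tensor m 0)); rewrite -tensorDr !addr0. Qed.

Fact tcons_fin v x : exists N, forall k, (N <= k)%N -> tcons_val v x k = 0.
Proof.
by exists (dbound x).+1 => -[|k] //= xk; rewrite dboundP // tensor0r.
Qed.
Definition tcons v x : tensalg := Dsum (tcons_fin v x).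

Lemma tconsDl x : {morph tcons^~ x : v w / v + w}.
Proof. by move=> v w; apply: dsumP => -[|k]; rewrite dvalD /= ?addr0 ?tensorDl. Qed.
Lemma tconsDr v : {morph tcons v : x y / x + y}.
Proof. by move=> x y; apply: dsumP => -[|k]; rewrite dvalD /= ?addr0 ?tensorDr. Qed.
Lemma tconsM v a x : tcons (ract v a) x = tcons v (a *: x).
Proof. by apply: dsumP => -[|k] //=; rewrite tensorM. Qed.
Lemma tcons_scale a v x : tcons (a *: v) x = a *: tcons v x.
Proof. by apply: dsumP => -[|k]; rewrite dvalZ /= ?scaler0 ?tensor_scale. Qed.
Lemma tcons0 v : tcons v 0 = 0.
Proof. by apply: (addrI (tcons v 0)); rewrite -tconsDr !addr0. Qed.

(* The product t.y of a homogeneous t = v1 (x) ... (x) vi (x) a with y is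
   v1 (x) ... (x) vi (x) a y. *)
Fixpoint lmulh (i : nat) : tpow i -> tensalg -> tensalg :=
  match i return tpow i -> tensalg -> tensalg with
  | 0 => fun a y => (a : A) *: y
  | i'.+1 => fun t y => tens_lift (fun v t' => tcons v (lmulh t' y)) t
  end.

Lemma lmulh_lin i y : {morph (@lmulh i)^~ y : s t / s + t} /\
  forall a t, lmulh (a *: t : tpow i) y = a *: lmulh t y.
Proof.
elim: i => [|i [IHD IHZ]] /=.
  by split=> [s t|a t]; rewrite ?scalerDl // -scalerA.
have bal : balanced (fun (v : V) (t' : tpow i) => tcons v (lmulh t' y)).
  split=> [t v w|v s t|v a t]; first by rewrite tconsDl.
  - by rewrite IHD tconsDr.
  - by rewrite IHZ tconsM.
split=> [s t|a t]; first exact: tens_liftD.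
elim/tensor_ind: t => [|v t|s t Hs Ht].
- by rewrite !(scaler0, tens_lift0).
- by rewrite tensor_scale !tens_liftE // tcons_scale.
- by rewrite scalerDr !tens_liftD // Hs Ht scalerDr.
Qed.

Lemma lmulhDl i y : {morph (@lmulh i)^~ y : s t / s + t}.
Proof. exact: (lmulh_lin i y).1. Qed.

Lemma lmulh_scale i a t y : lmulh (a *: t : tpow i) y = a *: lmulh t y.
Proof. exact: (lmulh_lin i y).2. Qed.

Lemma lmulh0l i y : lmulh (0 : tpow i) y = 0.
Proof. by apply: (addrI (lmulh (0 : tpow i) y)); rewrite -lmulhDl !addr0. Qed.

Lemma lmulhS i v (t : tpow i) y :
  @lmulh i.+1 (tensor v t) y = tcons v (lmulh t y).
Proof.
rewrite /= tens_liftE //; split=> [s w w'|w s s'|w a s].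
- by rewrite tconsDl.
- by rewrite lmulhDl tconsDr.
- by rewrite lmulh_scale tconsM.
Qed.

Lemma lmulhDr i (t : tpow i) : {morph lmulh t : y z / y + z}.
Proof.
move=> y z; elim: i t => [|i IHi] t; first by rewrite /= scalerDr.
elim/tensor_ind: t => [|v t|s t Hs Ht]; first by rewrite !lmulh0l addr0.
  by rewrite !lmulhS IHi tconsDr.
by rewrite !lmulhDl Hs Ht addrACA.
Qed.

Definition tmul x y : tensalg := \sum_(i < dbound x) lmulh (dval x i) y.
Definition tone : tensalg := dsum_in (1 : tpow 0).

Lemma tmulw N x y : (forall k, (N <= k)%N -> dval x k = 0) ->
  tmul x y = \sum_(i < N) lmulh (dval x i) y.
Proof.
have aux m n : (forall k, (m <= k)%N -> dval x k = 0) -> (m <= n)%N ->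
    \sum_(i < m) lmulh (dval x i) y = \sum_(i < n) lmulh (dval x i) y.
  move=> xm mn; rewrite (big_ord_widen n (fun i => lmulh (dval x i) y) mn).
  rewrite big_mkcond; apply: eq_bigr => i _; case: ltnP => // /xm ->.
  by rewrite lmulh0l.
move=> xN; rewrite /tmul; case/orP: (leq_total (dbound x) N) => le.
  by apply: aux le => k; apply: dboundP.
exact/esym/(aux _ _ xN le).
Qed.

Fact tmulDl : left_distributive tmul +%R.
Proof.
move=> x y z; set N := maxn (dbound x) (dbound y).
have xN k : (N <= k)%N -> dval x k = 0.
  by rewrite geq_max => /andP[le _]; apply: dboundP.
have yN k : (N <= k)%N -> dval y k = 0.
  by rewrite geq_max => /andP[_ le]; apply: dboundP.
rewrite (tmulw _ xN) (tmulw _ yN) (@tmulw N) => [|k Nk].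
  by rewrite -big_split; apply: eq_bigr => i _; exact: lmulhDl.
by rewrite dvalD xN // yN // addr0.
Qed.

Fact tmulDr : right_distributive tmul +%R.
Proof.
by move=> x y z; rewrite /tmul -big_split; apply: eq_bigr => i _; exact: lmulhDr.
Qed.

Lemma tmul0l y : tmul 0 y = 0.
Proof. by apply: (addrI (tmul 0 y)); rewrite -tmulDl !addr0. Qed.

Lemma tmul_cons v x y : tmul (tcons v x) y = tcons v (tmul x y).
Proof.
rewrite (@tmulw (dbound x).+1) => [|[|k] // xk]; last first.
  by rewrite /= dboundP // tensor0r.
rewrite big_ord_recl lmulh0l add0r /tmul (big_morph _ (tconsDr v) (tcons0 v)).
by apply: eq_bigr => i _; rewrite -lmulhS.
Qed.

Lemma tmul_scale a x y : tmul (a *: x) y = a *: tmul x y.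
Proof.
rewrite (@tmulw (dbound x)) => [|k xk]; last first.
  by rewrite dvalZ dboundP // scaler0.
by rewrite /tmul scaler_sumr; apply: eq_bigr => i _; rewrite -lmulh_scale.
Qed.

Lemma tmul_lmulh i (t : tpow i) x y : tmul (lmulh t x) y = lmulh t (tmul x y).
Proof.
elim: i t => [|i IHi] t; first exact: tmul_scale.
elim/tensor_ind: t => [|v t|s t Hs Ht]; first by rewrite !lmulh0l tmul0l.
  by rewrite !lmulhS tmul_cons IHi.
by rewrite !lmulhDl tmulDl Hs Ht.
Qed.

Fact tmulA : associative tmul.
Proof.
move=> x y z; rewrite {1}/tmul [tmul x y]/tmul.
rewrite [RHS](big_morph (tmul^~ z) (fun _ _ => tmulDl _ _ _) (tmul0l z)).
by apply: eq_bigr => i _; rewrite tmul_lmulh.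
Qed.

Fact tmul1 : left_id tone tmul.
Proof.
move=> x; rewrite (@tmulw 1) => [|k k1]; last by rewrite dsum_in_neq // eq_sym -lt0n.
rewrite big_ord_recl big_ord0 addr0 dsum_in_eq. exact: scale1r.
Qed.

Lemma lmulh_one i (t : tpow i) : lmulh t tone = dsum_in t.
Proof.
elim: i t => [|i IHi] t.
  apply: dsumP => k; have [<-|k0] := eqVneq 0 k.
    by rewrite dvalZ !dsum_in_eq; apply: mulr1.
  by rewrite dvalZ !dsum_in_neq // scaler0.
elim/tensor_ind: t => [|v t|s t Hs Ht].
- rewrite lmulh0l; apply: dsumP => k; rewrite dval0; have [<-|ik] := eqVneq i.+1 k.
    by rewrite dsum_in_eq.
  by rewrite dsum_in_neq.
- rewrite lmulhS IHi; apply: dsumP => -[|k]; first by rewrite dsum_in_neq.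
  change (tensor v (dsum_in t k) = dsum_in (tensor v t : tpow i.+1) k.+1).
  have [<-|ik] := eqVneq i k; first by rewrite !dsum_in_eq.
  by rewrite !dsum_in_neq // tensor0r.
- rewrite lmulhDl Hs Ht; apply: dsumP => k; rewrite dvalD.
  have [<-|ik] := eqVneq i.+1 k; first by rewrite !dsum_in_eq.
  by rewrite !dsum_in_neq // addr0.
Qed.

Fact tmulr1 : right_id tone tmul.
Proof.
move=> x; rewrite [RHS](dsum_decomp (leqnn (dbound x))).
by apply: eq_bigr => i _; apply: lmulh_one.
Qed.

HB.instance Definition _ := GRing.Zmodule_isPzRing.Build tensalg
  tmulA tmul1 tmulr1 tmulDl tmulDr.

Definition ta_base (a : A) : tensalg := a *: (1 : tensalg).
Definition ta_gen (v : V) : tensalg := tcons v 1.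

Lemma ta_base_mul a x : ta_base a * x = a *: x.
Proof. by rewrite /ta_base [LHS]tmul_scale; congr (_ *: _); exact: mul1r. Qed.

Lemma ta_gen_mul v x : ta_gen v * x = tcons v x.
Proof. by rewrite /ta_gen [LHS]tmul_cons; congr (tcons _ _); exact: mul1r. Qed.

Fact ta_base_zmod_morphism : zmod_morphism ta_base.
Proof. by move=> a b; rewrite /ta_base scalerBl. Qed.

Fact ta_base_monoid_morphism : monoid_morphism ta_base.
Proof.
split=> [|a b]; first exact: scale1r.
by rewrite ta_base_mul /ta_base scalerA.
Qed.

Lemma ta_base_central a x : (forall b, a * b = b * a) ->
  (forall v, a *: v = ract v a) -> ta_base a * x = x * ta_base a.
Proof.
move=> aC aV.
have lmulhZ i (t : tpow i) y : lmulh t (a *: y) = a *: lmulh t y.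
  elim: i t => [|i IHi] t; first by rewrite /= !scalerA aC.
  elim/tensor_ind: t => [|v t|s t Hs Ht]; first by rewrite !lmulh0l scaler0.
    by rewrite !lmulhS IHi -tconsM -aV tcons_scale.
  by rewrite !lmulhDl Hs Ht scalerDr.
rewrite ta_base_mul -[x in LHS]mulr1 -[LHS]tmul_scale.
rewrite [LHS]tmul_scale [LHS]scaler_sumr.
by apply: eq_bigr => i _; rewrite -lmulhZ.
Qed.

HB.instance Definition _ := GRing.isZmodMorphism.Build A tensalg ta_base
  ta_base_zmod_morphism.
HB.instance Definition _ := GRing.isMonoidMorphism.Build A tensalg ta_base
  ta_base_monoid_morphism.

Definition ta_deg (d : nat) (x : tensalg) : Prop :=
  forall k, k != d -> dval x k = 0.

End TensorAlgebra.

Section Frobenius.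
Variables (R S : comPzRingType) (f : {rmorphism R -> S}).

Definition linear_form (l : S -> R) : Prop :=
  forall r s t, l (f r * s + t) = r * l s + l t.

Definition is_basis n (e : 'I_n -> S) : Prop :=
  forall s, exists! c : {ffun 'I_n -> R}, s = \sum_i f (c i) * e i.

(* The isomorphism S -> Hom_R(S, R) is Phi; (a . l) x = l (a * x). *)
Definition relative_frobenius (n : nat) : Prop :=
  (exists e : 'I_n -> S, is_basis e) /\
  exists Phi : S -> S -> R,
    [/\ forall s, linear_form (Phi s),
        forall s t x, Phi (s + t) x = Phi s x + Phi t x,
        forall a s x, Phi (a * s) x = Phi s (a * x),
        forall s t, Phi s =1 Phi t -> s = t
      & forall l, linear_form l -> exists s, l =1 Phi s].

(* The choices made in the definition of the generalized preprojective
   algebra; they exist only if S/R is relative Frobenius of rank n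
   (frobenius_data_relative below). *)
Record frobenius_data n (l : S -> R) (e g : 'I_n -> S) : Prop := {
  fd_linear : linear_form l;
  fd_generator : forall m, linear_form m -> exists s, forall x, m x = l (s * x);
  fd_basisl : is_basis e;
  fd_basisr : is_basis g;
  fd_dual : forall i j, l (e i * g j) = (i == j)%:R
}.

Lemma linear_form_sum n (l : S -> R) (c : 'I_n -> R) (x : 'I_n -> S) :
  linear_form l -> l (\sum_i f (c i) * x i) = \sum_i c i * l (x i).
Proof.
move=> lin; have l0 : l 0 = 0.
  have := lin 1 0 0; rewrite mulr0 addr0 mul1r => l00.
  by apply: (addrI (l 0)); rewrite -l00 addr0.
elim/big_rec2: _ => [|i y z _ <-]; first exact: l0.
exact: lin.
Qed.

Lemma frobenius_data_relative n l (e g : 'I_n -> S) :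
  frobenius_data l e g -> relative_frobenius n.
Proof.
case=> lin gen be bg dual; split; first by exists e.
exists (fun s x => l (s * x)); split=> [s r x y|s t x|a s x|s t st|m /gen[s ms]].
- by rewrite mulrDr mulrCA lin.
- by rewrite mulrDl -[s * x in LHS]mul1r -(rmorph1 f) lin mul1r.
- by rewrite mulrCA mulrA.
- have [c [es _]] := be s; have [d [et _]] := be t.
  rewrite es et; apply: eq_bigr => j _; congr (f _ * _).
  have coef u (b : {ffun 'I_n -> R}) : u = \sum_i f (b i) * e i ->
      l (u * g j) = b j.
    move=> ->; rewrite mulr_suml; under eq_bigr => i _ do rewrite -mulrA.
    rewrite linear_form_sum // (bigD1 j) //= big1 => [|i /negPf ij].
      by rewrite dual eqxx mulr1 addr0.
    by rewrite dual ij mulr0.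
  by rewrite -(coef _ _ es) -(coef _ _ et).
- by exists s.
Qed.

End Frobenius.

Section GeneralizedPreprojective.
Variables (R S : comPzRingType) (f : {rmorphism R -> S}).

Local Notation A := (R * S)%type.

(* M = _R S_S and N = _S S_R as bimodules over R x S. The dummy let keeps f
   in the type, so that the bimodule structure can be found from it. *)
Definition bimM : Type := let _ := f in S.
Definition bimN : Type := let _ := f in S.

HB.instance Definition _ := GRing.Zmodule.on bimM.
HB.instance Definition _ := GRing.Zmodule.on bimN.

Definition bimM_scale (a : A) (m : bimM) : bimM := f a.1 * (m : S).
Definition bimM_ract (m : bimM) (a : A) : bimM := (m : S) * a.2.
Definition bimN_scale (a : A) (m : bimN) : bimN := a.2 * (m : S).
Definition bimN_ract (m : bimN) (a : A) : bimN := (m : S) * f a.1.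

Fact bimM_scaleA a b m : bimM_scale a (bimM_scale b m) = bimM_scale (a * b) m.
Proof. by rewrite /bimM_scale mulrA -rmorphM. Qed.
Fact bimM_scale1 : left_id 1 bimM_scale.
Proof. by move=> m; rewrite /bimM_scale rmorph1 mul1r. Qed.
Fact bimM_scaleDr : right_distributive bimM_scale +%R.
Proof. by move=> a x y; apply: mulrDr. Qed.
Fact bimM_scaleDl m : {morph bimM_scale^~ m : a b / a + b}.
Proof. by move=> a b; rewrite /bimM_scale rmorphD; apply: mulrDl. Qed.

HB.instance Definition _ := GRing.Zmodule_isLmodule.Build A bimM
  bimM_scaleA bimM_scale1 bimM_scaleDr bimM_scaleDl.

Fact bimM_ractDl a : {morph bimM_ract^~ a : x y / x + y}.
Proof. by move=> x y; apply: mulrDl. Qed.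
Fact bimM_ractDr m : {morph bimM_ract m : a b / a + b}.
Proof. by move=> a b; apply: mulrDr. Qed.
Fact bimM_ractM m a b : bimM_ract m (a * b) = bimM_ract (bimM_ract m a) b.
Proof. by apply: mulrA. Qed.
Fact bimM_ract1 m : bimM_ract m 1 = m.
Proof. by apply: mulr1. Qed.
Fact bimM_ract_scale (a : A) m b : bimM_ract (a *: m) b = a *: bimM_ract m b.
Proof. by apply/esym/mulrA. Qed.

HB.instance Definition _ := isBimodule.Build A A bimM
  bimM_ractDl bimM_ractDr bimM_ractM bimM_ract1 bimM_ract_scale.

Fact bimN_scaleA a b m : bimN_scale a (bimN_scale b m) = bimN_scale (a * b) m.
Proof. by apply: mulrA. Qed.
Fact bimN_scale1 : left_id 1 bimN_scale.
Proof. by move=> m; apply: mul1r. Qed.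
Fact bimN_scaleDr : right_distributive bimN_scale +%R.
Proof. by move=> a x y; apply: mulrDr. Qed.
Fact bimN_scaleDl m : {morph bimN_scale^~ m : a b / a + b}.
Proof. by move=> a b; apply: mulrDl. Qed.

HB.instance Definition _ := GRing.Zmodule_isLmodule.Build A bimN
  bimN_scaleA bimN_scale1 bimN_scaleDr bimN_scaleDl.

Fact bimN_ractDl a : {morph bimN_ract^~ a : x y / x + y}.
Proof. by move=> x y; apply: mulrDl. Qed.
Fact bimN_ractDr m : {morph bimN_ract m : a b / a + b}.
Proof. by move=> a b; rewrite /bimN_ract rmorphD; apply: mulrDr. Qed.
Fact bimN_ractM m a b : bimN_ract m (a * b) = bimN_ract (bimN_ract m a) b.
Proof. by rewrite /bimN_ract rmorphM; apply: mulrA. Qed.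
Fact bimN_ract1 m : bimN_ract m 1 = m.
Proof. by rewrite /bimN_ract rmorph1; apply: mulr1. Qed.
Fact bimN_ract_scale (a : A) m b : bimN_ract (a *: m) b = a *: bimN_ract m b.
Proof. by apply/esym/mulrA. Qed.

HB.instance Definition _ := isBimodule.Build A A bimN
  bimN_ractDl bimN_ractDr bimN_ractM bimN_ract1 bimN_ract_scale.

Definition tensRS : pzRingType := tensalg (bimM * bimN)%type.

Definition genM (m : S) : tensRS := ta_gen ((m, 0) : bimM * bimN).
Definition genN (m : S) : tensRS := ta_gen ((0, m) : bimM * bimN).

Variables (n : nat) (e g : 'I_n -> S).

Definition Pi_rel (x : tensRS) : Prop :=
  x = genM 1 * genN 1 \/ x = \sum_i genN (e i) * genM (g i).

Definition Pi : pzRingType := ringquot Pi_rel.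

Definition Pi_proj : {rmorphism tensRS -> Pi} := @rq_pi _ Pi_rel.

Definition Pi_scalar (r : R) : Pi := Pi_proj (ta_base _ (r, f r)).

Fact Pi_scalar_zmod_morphism : zmod_morphism Pi_scalar.
Proof.
move=> r s; rewrite /Pi_scalar.
have -> : (r - s, f (r - s)) = (r, f r) - (s, f s) :> A by rewrite rmorphB.
by rewrite !raddfB.
Qed.

Fact Pi_scalar_monoid_morphism : monoid_morphism Pi_scalar.
Proof.
split=> [|r s]; rewrite /Pi_scalar.
  have -> : (1, f 1) = 1 :> A by rewrite rmorph1.
  by rewrite !rmorph1.
have -> : (r * s, f (r * s)) = (r, f r) * (s, f s) :> A by rewrite rmorphM.
by rewrite !rmorphM.
Qed.

HB.instance Definition _ := GRing.isZmodMorphism.Build R Pi Pi_scalar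
  Pi_scalar_zmod_morphism.
HB.instance Definition _ := GRing.isMonoidMorphism.Build R Pi Pi_scalar
  Pi_scalar_monoid_morphism.

Lemma Pi_scalar_central r x : Pi_scalar r * x = x * Pi_scalar r.
Proof.
elim/rq_piP: x => x; rewrite /Pi_scalar /Pi_proj -!rmorphM ta_base_central //.
  by move=> a; rewrite mulrC.
by case=> m m'; congr (_, _); rewrite /GRing.scale /= /ract /=; apply: mulrC.
Qed.

Definition Pi_deg (d : nat) (x : Pi) : Prop :=
  exists2 t : tensRS, ta_deg d t & x = Pi_proj t.

End GeneralizedPreprojective.

Record quiver := Quiver {
  vertex : finType;
  arrow : finType;
  src : arrow -> vertex;
  tgt : arrow -> vertex
}.

Section PathAlgebra.
Variables (R : pzRingType) (Q : quiver).

(* (v, [:: a1; ...; ak]) stands for the path a1 ... ak starting at v; paths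
   compose from left to right. *)
Fixpoint composable (v : vertex Q) (s : seq (arrow Q)) : bool :=
  if s is a :: s' then (src a == v) && composable (tgt a) s' else true.

Definition qpath : Type :=
  {p : vertex Q * seq (arrow Q) | composable p.1 p.2}.

HB.instance Definition _ := SubChoice.on qpath.

Definition qstart (p : qpath) : vertex Q := (val p).1.
Definition qarrows (p : qpath) : seq (arrow Q) := (val p).2.
Definition walk_end (v : vertex Q) (s : seq (arrow Q)) := last v (map (@tgt Q) s).
Definition qend (p : qpath) : vertex Q := walk_end (qstart p) (qarrows p).

Lemma composable_cat v s t :
  composable v (s ++ t) = composable v s && composable (walk_end v s) t.
Proof. by elim: s v => //= a s IHs v; rewrite IHs andbA. Qed.

Definition qvertex (v : vertex Q) : qpath := exist _ (v, [::]) isT.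

Fact qarrow_subproof (a : arrow Q) : composable (src a) [:: a].
Proof. by rewrite /= eqxx. Qed.
Definition qarrow (a : arrow Q) : qpath := exist _ (src a, [:: a]) (qarrow_subproof a).

Fact qcat_subproof (p q : qpath) : qend p = qstart q ->
  composable (qstart p) (qarrows p ++ qarrows q).
Proof.
move=> pq; rewrite composable_cat -/(qend p) pq.
by rewrite (valP p) (valP q).
Qed.
Definition qcat (p q : qpath) (pq : qend p = qstart q) : qpath :=
  exist _ (qstart p, qarrows p ++ qarrows q) (qcat_subproof pq).

Definition pathalg : Type := {malg R[qpath]}.
HB.instance Definition _ := GRing.Zmodule.on pathalg.

Definition pmono (c : R) (p : qpath) : pathalg := << c *g p >>.

Definition pmul (c : R) (p q : qpath) : pathalg :=
  if @eqP _ (qend p) (qstart q) is ReflectT pq then pmono c (qcat pq) else 0.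

Definition pa_mul (x y : pathalg) : pathalg :=
  \sum_(p <- msupp x) \sum_(q <- msupp y) pmul (x@_p * y@_q) p q.

Definition pa_one : pathalg := \sum_(v : vertex Q) pmono 1 (qvertex v).

Lemma pmonoD p : {morph pmono^~ p : c d / c + d}.
Proof. exact: monalgUD. Qed.
Lemma pmono0 p : pmono 0 p = 0.
Proof. exact: monalgU0. Qed.

Lemma pmulD p q : {morph (fun c => pmul c p q) : c d / c + d}.
Proof. by move=> c d; rewrite /pmul; case: eqP => pq; [apply: pmonoD | rewrite addr0]. Qed.
Lemma pmul0 p q : pmul 0 p q = 0.
Proof. by rewrite /pmul; case: eqP => pq; rewrite ?pmono0. Qed.

Lemma pmulE c p q (pq : qend p = qstart q) : pmul c p q = pmono c (qcat pq).
Proof.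
by rewrite /pmul; case: eqP => // pq'; rewrite (eq_irrelevance pq pq').
Qed.
Lemma pmul_neq c p q : qend p <> qstart q -> pmul c p q = 0.
Proof. by rewrite /pmul; case: eqP. Qed.

Lemma pa_mulw (d1 d2 : {fset qpath}) x y :
  (msupp x `<=` d1)%fset -> (msupp y `<=` d2)%fset ->
  pa_mul x y = \sum_(p <- d1) \sum_(q <- d2) pmul (x@_p * y@_q) p q.
Proof.
move=> xd1 yd2; rewrite /pa_mul (big_fset_incl _ xd1) /= => [|p _ /mcoeff_outdom xp].
  apply: eq_bigr => p _; apply: big_fset_incl => // q _ /mcoeff_outdom ->.
  by rewrite mulr0 pmul0.
by rewrite big1 // => q _; rewrite xp mul0r pmul0.
Qed.

Fact pa_mulDl : left_distributive pa_mul +%R.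
Proof.
move=> x y z; rewrite (pa_mulw (msuppD_le x y) (fsubset_refl (msupp z))).
rewrite (pa_mulw (fsubsetUl (msupp x) (msupp y)) (fsubset_refl (msupp z))).
rewrite (pa_mulw (fsubsetUr (msupp x) (msupp y)) (fsubset_refl (msupp z))).
rewrite -big_split; apply: eq_bigr => p _ /=.
by rewrite -big_split; apply: eq_bigr => q _ /=; rewrite mcoeffD mulrDl pmulD.
Qed.

Fact pa_mulDr : right_distributive pa_mul +%R.
Proof.
move=> z x y; rewrite (pa_mulw (fsubset_refl (msupp z)) (msuppD_le x y)).
rewrite (pa_mulw (fsubset_refl (msupp z)) (fsubsetUl (msupp x) (msupp y))).
rewrite (pa_mulw (fsubset_refl (msupp z)) (fsubsetUr (msupp x) (msupp y))).
rewrite -big_split; apply: eq_bigr => p _ /=.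
by rewrite -big_split; apply: eq_bigr => q _ /=; rewrite mcoeffD mulrDr pmulD.
Qed.

Lemma pa_mul0l x : pa_mul 0 x = 0.
Proof. by apply: (addrI (pa_mul 0 x)); rewrite -pa_mulDl !addr0. Qed.
Lemma pa_mul0r x : pa_mul x 0 = 0.
Proof. by apply: (addrI (pa_mul x 0)); rewrite -pa_mulDr !addr0. Qed.

Lemma pa_mul_mono c d p q : pa_mul (pmono c p) (pmono d q) = pmul (c * d) p q.
Proof. by rewrite (pa_mulw msuppU_le msuppU_le) !big_seq_fset1 !mcoeffUU. Qed.

Lemma pathalg_ind (P : pathalg -> Prop) : P 0 ->
  (forall c p, P (pmono c p)) -> (forall x y, P x -> P y -> P (x + y)) ->
  forall x, P x.
Proof.
by move=> P0 Pm PD x; rewrite [x]monalgE; elim/big_rec: _ => // p y _ Py;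
apply: PD => //; apply: Pm.
Qed.

Lemma qpath_eq (p q : qpath) :
  qstart p = qstart q -> qarrows p = qarrows q -> p = q.
Proof.
case: p q => [[v s] ?] [[w t] ?]; rewrite /qstart /qarrows /= => vw st.
by apply: val_inj; rewrite /= vw st.
Qed.

Lemma qend_cat p q (pq : qend p = qstart q) : qend (qcat pq) = qend q.
Proof.
change (walk_end (qstart p) (qarrows p ++ qarrows q) = qend q).
by rewrite /walk_end map_cat last_cat -[last (qstart p) _]/(qend p) pq.
Qed.

Fact pa_mulA : associative pa_mul.
Proof.
move=> x y z; elim/pathalg_ind: x => [|c p|x x' Hx Hx'].
- by rewrite !pa_mul0l.
- elim/pathalg_ind: y => [|d q|y y' Hy Hy'].
  + by rewrite pa_mul0l !pa_mul0r pa_mul0l.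
  + elim/pathalg_ind: z => [|e r|z z' Hz Hz'].
    * by rewrite !pa_mul0r.
    * rewrite !pa_mul_mono.
      have [pq|pq] := eqVneq (qend p) (qstart q); last first.
        rewrite (pmul_neq _ (elimN eqP pq)) pa_mul0l.
        have [qr|/eqP qr] := eqVneq (qend q) (qstart r); last first.
          by rewrite pmul_neq // pa_mul0r.
        by rewrite (pmulE _ qr) pa_mul_mono pmul_neq //; apply/eqP.
      rewrite (pmulE _ pq) pa_mul_mono.
      have [qr|/eqP qr] := eqVneq (qend q) (qstart r); last first.
        by rewrite !pmul_neq ?pa_mul0r // qend_cat.
      have pqr : qend p = qstart (qcat qr) by [].
      have pqr' : qend (qcat pq) = qstart r by rewrite qend_cat.
      rewrite (pmulE _ qr) pa_mul_mono (pmulE _ pqr) (pmulE _ pqr') mulrA.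
      congr pmono; apply: qpath_eq => //.
      by rewrite /qarrows /= catA.
    * by rewrite !pa_mulDr Hz Hz'.
  + by rewrite pa_mulDl !pa_mulDr pa_mulDl Hy Hy'.
- by rewrite !pa_mulDl Hx Hx'.
Qed.

Definition pa_scalar (r : R) : pathalg :=
  \sum_(v : vertex Q) pmono r (qvertex v).

Lemma pa_scalar_mul r c p : pa_mul (pa_scalar r) (pmono c p) = pmono (r * c) p.
Proof.
rewrite (big_morph (pa_mul^~ _) (fun _ _ => pa_mulDl _ _ _) (pa_mul0l _)).
rewrite (bigD1 (qstart p)) //= big1 ?addr0 => [|v /eqP vp].
  have e : qend (qvertex (qstart p)) = qstart p by [].
  by rewrite pa_mul_mono (pmulE _ e); congr pmono; apply: qpath_eq.
by rewrite pa_mul_mono pmul_neq.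
Qed.

Lemma pa_mul_scalar r c p : pa_mul (pmono c p) (pa_scalar r) = pmono (c * r) p.
Proof.
rewrite (big_morph (pa_mul _) (fun _ _ => pa_mulDr _ _ _) (pa_mul0r _)).
rewrite (bigD1 (qend p)) //= big1 ?addr0 => [|v /eqP vp].
  have e : qend p = qstart (qvertex (qend p)) by [].
  rewrite pa_mul_mono (pmulE _ e); congr pmono; apply: qpath_eq => //.
  by rewrite /qarrows /= cats0.
by rewrite pa_mul_mono pmul_neq // => /esym.
Qed.

Fact pa_mul1 : left_id pa_one pa_mul.
Proof.
elim/pathalg_ind => [|c p|x y Hx Hy]; first exact: pa_mul0r.
  by rewrite pa_scalar_mul mul1r.
by rewrite pa_mulDr Hx Hy.
Qed.

Fact pa_mulr1 : right_id pa_one pa_mul.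
Proof.
elim/pathalg_ind => [|c p|x y Hx Hy]; first exact: pa_mul0l.
  by rewrite pa_mul_scalar mulr1.
by rewrite pa_mulDl Hx Hy.
Qed.

HB.instance Definition _ := GRing.Zmodule_isPzRing.Build pathalg
  pa_mulA pa_mul1 pa_mulr1 pa_mulDl pa_mulDr.

Fact pa_scalar_zmod_morphism : zmod_morphism pa_scalar.
Proof.
by move=> r s; rewrite /pa_scalar -sumrB; apply: eq_bigr => v _; apply: monalgUB.
Qed.

Fact pa_scalar_monoid_morphism : monoid_morphism pa_scalar.
Proof.
split=> // r s; rewrite {2}/pa_scalar mulr_sumr.
by apply: eq_bigr => v _; apply/esym/pa_scalar_mul.
Qed.

HB.instance Definition _ := GRing.isZmodMorphism.Build R pathalg pa_scalar
  pa_scalar_zmod_morphism.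
HB.instance Definition _ := GRing.isMonoidMorphism.Build R pathalg pa_scalar
  pa_scalar_monoid_morphism.

Definition pa_arrow (a : arrow Q) : pathalg := pmono 1 (qarrow a).

Definition pa_deg (d : nat) (x : pathalg) : Prop :=
  forall p, p \in msupp x -> size (qarrows p) = d.

End PathAlgebra.

Lemma pa_scalar_central (R : comPzRingType) (Q : quiver) r (x : pathalg R Q) :
  pa_scalar Q r * x = x * pa_scalar Q r.
Proof.
elim/pathalg_ind: x => [|c p|x y Hx Hy]; first by rewrite mul0r mulr0.
  by rewrite [LHS]pa_scalar_mul [RHS]pa_mul_scalar mulrC.
by rewrite mulrDl mulrDr Hx Hy.
Qed.

(* inr a is the reversed arrow a^*. *)
Definition double_quiver (Q : quiver) : quiver :=
  @Quiver (vertex Q) (arrow Q + arrow Q)%type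
    (fun b => match b with inl a => src a | inr a => tgt a end)
    (fun b => match b with inl a => tgt a | inr a => src a end).

(* None is the central vertex. *)
Definition star (n : nat) : quiver :=
  @Quiver (option 'I_n) 'I_n (fun=> None) (fun i => Some i).

Section Preprojective.
Variables (R : comPzRingType) (n : nat).

Local Notation RQ := (pathalg R (double_quiver (star n))).

Definition star_arrow (i : 'I_n) : RQ :=
  pa_arrow R (inl i : arrow (double_quiver (star n))).
Definition star_arrow' (i : 'I_n) : RQ :=
  pa_arrow R (inr i : arrow (double_quiver (star n))).

Definition preproj_rel (x : RQ) : Prop :=
  x = \sum_i star_arrow i * star_arrow' i \/
  x = \sum_i star_arrow' i * star_arrow i.

Definition preproj : pzRingType := ringquot preproj_rel.

Definition preproj_proj : {rmorphism RQ -> preproj} := @rq_pi _ preproj_rel.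

Definition preproj_scalar (r : R) : preproj :=
  preproj_proj (pa_scalar (double_quiver (star n)) r).

Fact preproj_scalar_zmod_morphism : zmod_morphism preproj_scalar.
Proof. by move=> r s; rewrite /preproj_scalar !raddfB. Qed.

Fact preproj_scalar_monoid_morphism : monoid_morphism preproj_scalar.
Proof.
split=> [|r s]; rewrite /preproj_scalar; first by rewrite !rmorph1.
by rewrite !rmorphM.
Qed.

HB.instance Definition _ := GRing.isZmodMorphism.Build R preproj preproj_scalar
  preproj_scalar_zmod_morphism.
HB.instance Definition _ := GRing.isMonoidMorphism.Build R preproj preproj_scalar
  preproj_scalar_monoid_morphism.

Lemma preproj_scalar_central r x : preproj_scalar r * x = x * preproj_scalar r.
Proof.
by elim/rq_piP: x => x; rewrite /preproj_scalar -!rmorphM pa_scalar_central.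
Qed.

Definition preproj_deg (d : nat) (x : preproj) : Prop :=
  exists2 t : RQ, pa_deg d t & x = preproj_proj t.

End Preprojective.

HB.instance Definition _ (I : finType) (R : comPzRingType) :=
  GRing.PzRing_hasCommutativeMul.Build {ffun I -> R} (@ffun_mulC I R).

Section Split.
Variables (R : comPzRingType) (n : nat).

Definition diag (r : R) : {ffun 'I_n -> R} := [ffun=> r].

Fact diag_zmod_morphism : zmod_morphism diag.
Proof. by move=> r s; apply/ffunP => i; rewrite !ffunE. Qed.
Fact diag_monoid_morphism : monoid_morphism diag.
Proof. by split=> [|r s]; apply/ffunP => i; rewrite !ffunE. Qed.

HB.instance Definition _ := GRing.isZmodMorphism.Build R {ffun 'I_n -> R} diag
  diag_zmod_morphism.
HB.instance Definition _ := GRing.isMonoidMorphism.Build R {ffun 'I_n -> R} diag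
  diag_monoid_morphism.

Definition idem (i : 'I_n) : {ffun 'I_n -> R} := [ffun j => (i == j)%:R].

Lemma idem_decomp (c : {ffun 'I_n -> R}) : c = \sum_i diag (c i) * idem i.
Proof.
apply/ffunP => j; rewrite sum_ffunE (bigD1 j) //= big1 => [|i /negPf ij].
  by rewrite !ffunE eqxx mulr1 addr0.
by rewrite !ffunE ij mulr0.
Qed.

Lemma idem_basis : is_basis diag idem.
Proof.
move=> s; exists s; split=> [|c ->]; first exact: idem_decomp.
exact/esym/idem_decomp.
Qed.

Lemma split_frobenius_data :
  frobenius_data diag (fun s : {ffun 'I_n -> R} => \sum_i s i) idem idem.
Proof.
have lin : linear_form diag (fun s : {ffun 'I_n -> R} => \sum_i s i).
  move=> r s t; rewrite mulr_sumr -big_split; apply: eq_bigr => i _.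
  by rewrite !ffunE.
split=> //; try exact: idem_basis.
  move=> m linm; exists [ffun i => m (idem i)] => x.
  rewrite {1}[x]idem_decomp linear_form_sum //; apply: eq_bigr => i _.
  by rewrite !ffunE mulrC.
move=> i j; rewrite (bigD1 j) //= big1 => [|k /negPf kj].
  by rewrite !ffunE eqxx mulr1 addr0.
by rewrite !ffunE [j == k]eq_sym kj mulr0.
Qed.

End Split.

(* Main.v *)
Require Import Defs.
From HB Require Import structures.
From mathcomp Require Import all_boot all_order all_algebra.
From mathcomp Require Import finmap monalg.

Set Implicit Arguments.
Unset Strict Implicit.
Unset Printing Implicit Defensive.

Import GRing.Theory.
Local Open Scope ring_scope.

(* A path in the double of the star is a monomial in the idempotents of R x R^n
   and the arrows, so sending the i-th idempotent of M = S to a_i and that of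
   N = S to a_i^* identifies T(R, S) with the path algebra. Under this
   isomorphism 1 (x) 1 becomes sum_i a_i a_i^*. A generator l of Hom_R(S, R) is
   s |-> sum_i u_i s_i for a unit u = (u_i) of S, so for any pair of l-dual bases
   sum_k e_k (x) g_k becomes sum_i u_i^-1 a_i^* a_i, which generates the same
   ideal as sum_i a_i^* a_i. *)

(** * Ring morphisms and quotients by two-sided ideals *)

(** Several maps below are morphisms only under local hypotheses, so the structure is packed inside
    a proof and passed on existentially. *)
Lemma rmorphism_exists (A B : pzRingType) (f : A -> B) :
  zmod_morphism f -> monoid_morphism f ->
  exists phi : {rmorphism A -> B}, phi =1 f.
Proof.
move=> fB fM.
pose phi := HB.pack_for {rmorphism A -> B} f
  (GRing.isZmodMorphism.Build A B f fB) (GRing.isMonoidMorphism.Build A B f fM).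
by exists phi.
Qed.

Lemma morphD_zmod_morphism (U W : zmodType) (f : U -> W) :
  {morph f : x y / x + y} -> zmod_morphism f.
Proof. by move=> fD x y; apply/eqP; rewrite eq_sym subr_eq -fD subrK. Qed.

Lemma rmorph_ideal_gen (A B : pzRingType) (G : A -> Prop) (H : B -> Prop)
    (F : {rmorphism A -> B}) :
  (forall x, G x -> ideal_gen H (F x)) ->
  forall x, ideal_gen G x -> ideal_gen H (F x).
Proof.
move=> FG x; elim=> {x} [x /FG //||x y _ IHx _ IHy|a x _ IHx|a x _ IHx].
- by rewrite rmorph0; apply: ideal_gen0.
- by rewrite rmorphB; apply: ideal_genB.
- by rewrite rmorphM; apply: ideal_genMl.
- by rewrite rmorphM; apply: ideal_genMr.
Qed.

(** The induced map applies [F] to a chosen representative; another choice changes the value by an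
    element of the target ideal. *)
Lemma ringquot_map (A B : pzRingType) (G : A -> Prop) (H : B -> Prop)
    (F : {rmorphism A -> B}) :
  (forall x, G x -> ideal_gen H (F x)) ->
  exists phi : {rmorphism ringquot G -> ringquot H},
    forall x, phi (@rq_pi A G x) = @rq_pi B H (F x).
Proof.
move=> FG; pose phi (q : ringquot G) : ringquot H := rq_pi H (F (repr q)).
have phiE x : phi (rq_pi G x) = rq_pi H (F x).
  apply/rq_pi_eq; rewrite -rmorphB; apply: (rmorph_ideal_gen FG).
  by apply/rq_pi_eq; apply: rq_pi_repr.
have phiB : zmod_morphism phi.
  by elim/rq_piP=> x; elim/rq_piP=> y; rewrite -raddfB !phiE !raddfB.
have phiM : monoid_morphism phi.
  split=> [|]; first by rewrite -(rmorph1 (rq_pi G)) phiE !rmorph1.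
  by elim/rq_piP=> x; elim/rq_piP=> y; rewrite -rmorphM !phiE !rmorphM.
have [psi psiE] := rmorphism_exists phiB phiM.
by exists psi => x; rewrite psiE phiE.
Qed.

(** * The universal property of the tensor algebra *)

Section TensorAlgebra.
Variables (A : pzRingType) (V : bimodType A A).

Lemma ta_base_gen a (v : V) : ta_base V a * ta_gen v = ta_gen (a *: v).
Proof. by rewrite ta_base_mul /ta_gen tcons_scale. Qed.

Lemma ta_gen_base (v : V) a : ta_gen v * ta_base V a = ta_gen (ract v a).
Proof. by rewrite ta_gen_mul /ta_gen tconsM. Qed.

Lemma ta_genD : {morph @ta_gen A V : v w / v + w}.
Proof. by move=> v w; apply: tconsDl. Qed.

Lemma ta_gen0 : ta_gen (0 : V) = 0.
Proof. by apply: (addrI (ta_gen (0 : V))); rewrite -ta_genD !addr0. Qed.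

(** Letting a homogeneous tensor act on the unit ([lmulh_one]) turns pure tensors into products of
    generators. The predicate carries the degree so that both inductions below are instances. *)
Lemma dsum_in_ind (P : nat -> tensalg V -> Prop) :
  (forall k, P k 0) -> (forall a, P 0 (ta_base V a)) ->
  (forall k v x, P k x -> P k.+1 (ta_gen v * x)) ->
  (forall k x y, P k x -> P k y -> P k (x + y)) ->
  forall k (t : tpow V k), P k (dsum_in t).
Proof.
move=> P0 Pb Pg PD; elim=> [|k IHk] t; first by rewrite -lmulh_one; apply: Pb.
elim/tensor_ind: t => [|v t|s t Hs Ht]; rewrite -lmulh_one.
- by rewrite lmulh0l.
- by rewrite lmulhS lmulh_one -ta_gen_mul; apply: Pg.
- by rewrite lmulhDl !lmulh_one; apply: PD.
Qed.

Lemma tensalg_ind (P : tensalg V -> Prop) :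
  (forall a, P (ta_base V a)) -> (forall v x, P x -> P (ta_gen v * x)) ->
  (forall x y, P x -> P y -> P (x + y)) -> forall x, P x.
Proof.
move=> Pb Pg PD x; have P0 : P 0 by rewrite -(raddf0 (ta_base V)); apply: Pb.
rewrite (dsum_decomp (leqnn (dbound x))); elim/big_rec: _ => // i y _ Py.
apply: (PD) => //; move: (i : nat) (dval x i) => k t.
exact: (@dsum_in_ind (fun=> P)).
Qed.

(** A homogeneous element is the inclusion of its only possibly nonzero component. *)
Lemma ta_deg_ind (P : nat -> tensalg V -> Prop) :
  (forall k, P k 0) -> (forall a, P 0 (ta_base V a)) ->
  (forall k v x, P k x -> P k.+1 (ta_gen v * x)) ->
  (forall k x y, P k x -> P k y -> P k (x + y)) ->
  forall k x, ta_deg k x -> P k x.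
Proof.
move=> P0 Pb Pg PD k x xk.
have -> : x = dsum_in (dval x k).
  apply: dsumP => j; have [<-|kj] := eqVneq k j; first by rewrite dsum_in_eq.
  by rewrite dsum_in_neq // (xk j) // eq_sym.
exact: dsum_in_ind.
Qed.

Lemma ta_deg0 d : ta_deg d (0 : tensalg V).
Proof. by []. Qed.

Lemma ta_degD d (x y : tensalg V) :
  ta_deg d x -> ta_deg d y -> ta_deg d (x + y).
Proof. by move=> xd yd k kd; rewrite dvalD xd // yd // addr0. Qed.

Lemma ta_deg_base a : ta_deg 0 (ta_base V a).
Proof. by move=> k k0; rewrite dvalZ dsum_in_neq ?scaler0 // eq_sym. Qed.

Lemma ta_deg_base_mul d a (x : tensalg V) :
  ta_deg d x -> ta_deg d (ta_base V a * x).
Proof. by move=> xd k kd; rewrite ta_base_mul dvalZ xd // scaler0. Qed.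

Lemma ta_deg_gen_mul d (v : V) x : ta_deg d x -> ta_deg d.+1 (ta_gen v * x).
Proof. by move=> xd [|k] kd; rewrite ta_gen_mul //= xd // tensor0r. Qed.

Variables (B : pzRingType) (b : {rmorphism A -> B}) (h : V -> B).
Hypotheses (hD : {morph h : v w / v + w})
  (hZ : forall a v, h (a *: v) = b a * h v)
  (hM : forall v a, h (ract v a) = h v * b a).

(** A pure tensor with factors [v1, ..., vk] and final scalar [a] goes to the product of
    [h v1, ..., h vk, b a]. *)
Fixpoint tpow_lift (k : nat) : tpow V k -> B :=
  match k return tpow V k -> B with
  | 0 => fun a => b a
  | k'.+1 => tens_lift (fun v t => h v * tpow_lift t)
  end.

(** [tens_lift] is meaningful only for balanced maps, and balancedness at level [k.+1] needs
    additivity and linearity at level [k]; hence one joint induction. *)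
Lemma tpow_lift_lin k : {morph @tpow_lift k : s t / s + t} /\
  forall a (t : tpow V k), tpow_lift (a *: t) = b a * tpow_lift t.
Proof.
elim: k => [|k [IHD IHZ]].
  by split=> [s t|a t] /=; [apply: rmorphD | apply: rmorphM].
have bal : balanced (fun v (t : tpow V k) => h v * tpow_lift t).
  split=> [t v w|v s t|v a t]; first by rewrite hD mulrDl.
  - by rewrite IHD mulrDr.
  - by rewrite IHZ hM mulrA.
split=> [s t|a t] /=; first exact: tens_liftD.
elim/tensor_ind: t => [|v t|s t Hs Ht].
- by rewrite !(scaler0, tens_lift0) // mulr0.
- by rewrite tensor_scale !tens_liftE // hZ mulrA.
- by rewrite scalerDr !tens_liftD // Hs Ht mulrDr.
Qed.

Lemma tpow_liftD k : {morph @tpow_lift k : s t / s + t}.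
Proof. exact: (tpow_lift_lin k).1. Qed.

Lemma tpow_liftZ k a (t : tpow V k) : tpow_lift (a *: t) = b a * tpow_lift t.
Proof. exact: (tpow_lift_lin k).2. Qed.

Lemma tpow_lift0 k : tpow_lift (0 : tpow V k) = 0.
Proof. by rewrite -(scale0r 0) tpow_liftZ rmorph0 mul0r. Qed.

Lemma tpow_liftS k v (t : tpow V k) :
  @tpow_lift k.+1 (tensor v t) = h v * tpow_lift t.
Proof.
rewrite /= tens_liftE //; split=> [s w w'|w s s'|w a s].
- by rewrite hD mulrDl.
- by rewrite tpow_liftD mulrDr.
- by rewrite tpow_liftZ hM mulrA.
Qed.

Definition ta_lift (x : tensalg V) : B :=
  \sum_(i < dbound x) tpow_lift (dval x i).

(** [dbound] is an arbitrary bound obtained by choice. Components past any valid bound contribute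
    zero, so the sum may be cut at a convenient length. *)
Lemma ta_liftw N x : (forall k, (N <= k)%N -> dval x k = 0) ->
  ta_lift x = \sum_(i < N) tpow_lift (dval x i).
Proof.
have aux m p : (forall k, (m <= k)%N -> dval x k = 0) -> (m <= p)%N ->
    \sum_(i < m) tpow_lift (dval x i) = \sum_(i < p) tpow_lift (dval x i).
  move=> xm mp; rewrite (big_ord_widen p (fun i => tpow_lift (dval x i)) mp).
  rewrite big_mkcond; apply: eq_bigr => i _; case: ltnP => // /xm ->.
  by rewrite tpow_lift0.
move=> xN; case/orP: (leq_total (dbound x) N) => le.
  by apply: aux le => k; apply: dboundP.
exact/esym/(aux _ _ xN le).
Qed.

Lemma ta_liftD : {morph ta_lift : x y / x + y}.
Proof.
move=> x y; set N := maxn (dbound x) (dbound y).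
have xN k : (N <= k)%N -> dval x k = 0.
  by rewrite geq_max => /andP[le _]; apply: dboundP.
have yN k : (N <= k)%N -> dval y k = 0.
  by rewrite geq_max => /andP[_ le]; apply: dboundP.
rewrite (ta_liftw xN) (ta_liftw yN) (@ta_liftw N) => [|k Nk].
  by rewrite -big_split; apply: eq_bigr => i _; exact: tpow_liftD.
by rewrite dvalD xN // yN // addr0.
Qed.

Lemma ta_lift_base_mul a x : ta_lift (ta_base V a * x) = b a * ta_lift x.
Proof.
rewrite ta_base_mul (@ta_liftw (dbound x)) => [|k xk]; last first.
  by rewrite dvalZ dboundP // scaler0.
by rewrite mulr_sumr; apply: eq_bigr => i _; rewrite -tpow_liftZ.
Qed.

Lemma ta_lift_gen_mul v x : ta_lift (ta_gen v * x) = h v * ta_lift x.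
Proof.
rewrite ta_gen_mul (@ta_liftw (dbound x).+1) => [|[|k] // xk]; last first.
  by rewrite /= dboundP // tensor0r.
(* A generator shifts degrees by one, and the new component in degree 0 vanishes. *)
rewrite big_ord_recl tpow_lift0 add0r mulr_sumr.
by apply: eq_bigr => i _; rewrite -tpow_liftS.
Qed.

Lemma ta_lift1 : ta_lift 1 = 1.
Proof.
rewrite (@ta_liftw 1) => [|k k1]; last by rewrite dsum_in_neq // eq_sym -lt0n.
by rewrite big_ord1 dsum_in_eq /= rmorph1.
Qed.

(** Multiplicativity follows by induction on the left factor, since [ta_lift] respects left
    multiplication by scalars and by generators. *)
Lemma tensalg_lift :
  exists F : {rmorphism tensalg V -> B},
    (forall a, F (ta_base V a) = b a) /\ (forall v, F (ta_gen v) = h v).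
Proof.
have [||F FE] := @rmorphism_exists _ _ ta_lift.
- exact/morphD_zmod_morphism/ta_liftD.
- split=> [|x y]; first exact: ta_lift1.
  elim/tensalg_ind: x => [a|v x IHx|x x' IHx IHx'].
  + rewrite ta_lift_base_mul -[ta_base V a]mulr1 ta_lift_base_mul.
    by rewrite ta_lift1 mulr1.
  + by rewrite -mulrA !ta_lift_gen_mul IHx mulrA.
  + by rewrite mulrDl !ta_liftD IHx IHx' mulrDl.
exists F; split=> [a|v]; rewrite FE.
  by rewrite -[ta_base V a]mulr1 ta_lift_base_mul ta_lift1 mulr1.
by rewrite -[ta_gen v]mulr1 ta_lift_gen_mul ta_lift1 mulr1.
Qed.

End TensorAlgebra.

(** * The universal property of the path algebra *)

Section PathAlgebra.
Variables (R : pzRingType) (Q : quiver).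

Implicit Types (p q : qpath Q) (x y : pathalg R Q) (k : vertex Q -> R).

Lemma pmono_mul c d p q (pq : qend p = qstart q) :
  pmono c p * pmono d q = pmono (c * d) (qcat pq) :> pathalg R Q.
Proof. by rewrite [LHS]pa_mul_mono (pmulE _ pq). Qed.

Lemma pmono_mul_neq c d p q : qend p <> qstart q ->
  pmono c p * pmono d q = 0 :> pathalg R Q.
Proof. by move=> pq; rewrite [LHS]pa_mul_mono pmul_neq. Qed.

(** One shape for two uses: elements of [R x S] become combinations of trivial paths, those of [M]
    and [N] combinations of arrows. *)
Definition pa_comb (I : finType) (s : I -> R) (p : I -> qpath Q) : pathalg R Q :=
  \sum_i pmono (s i) (p i).

Definition pa_diag k : pathalg R Q := pa_comb k (@qvertex Q).

Lemma eq_pa_comb (I : finType) (s t : I -> R) (p : I -> qpath Q) :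
  s =1 t -> pa_comb s p = pa_comb t p.
Proof. by move=> st; apply: eq_bigr => i _; rewrite st. Qed.

Lemma pa_combD (I : finType) (s t : I -> R) (p : I -> qpath Q) :
  pa_comb (fun i => s i + t i) p = pa_comb s p + pa_comb t p.
Proof. by rewrite -big_split; apply: eq_bigr => i _; apply: pmonoD. Qed.

Lemma pa_combB (I : finType) (s t : I -> R) (p : I -> qpath Q) :
  pa_comb (fun i => s i - t i) p = pa_comb s p - pa_comb t p.
Proof. by rewrite -sumrB; apply: eq_bigr => i _; apply: monalgUB. Qed.

Lemma pa_comb_delta (I : finType) (i : I) (p : I -> qpath Q) :
  pa_comb (fun j => (i == j)%:R) p = pmono 1 (p i).
Proof.
rewrite [LHS](bigD1 i) //= [X in _ + X]big1 ?addr0 ?eqxx // => j /negPf ji.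
by rewrite eq_sym ji [LHS]pmono0.
Qed.

(** Only the trivial path at the start of [p] composes with [p], so a diagonal element acts through
    its weight there. *)
Lemma pa_diag_mul k c p : pa_diag k * pmono c p = pmono (k (qstart p) * c) p.
Proof.
rewrite mulr_suml (bigD1 (qstart p)) //= big1 ?addr0 => [|v /eqP vp].
  have e : qend (qvertex (qstart p)) = qstart p by [].
  by rewrite (pmono_mul _ _ e); congr pmono; apply: qpath_eq.
by rewrite pmono_mul_neq.
Qed.

Lemma pa_mul_diag k c p : pmono c p * pa_diag k = pmono (c * k (qend p)) p.
Proof.
rewrite mulr_sumr (bigD1 (qend p)) //= big1 ?addr0 => [|v /eqP vp].
  have e : qend p = qstart (qvertex (qend p)) by [].
  rewrite (pmono_mul _ _ e); congr pmono; apply: qpath_eq => //.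
  by rewrite /qarrows /= cats0.
by rewrite pmono_mul_neq // => /esym.
Qed.

Lemma pa_diag_mul_comb (I : finType) k (s : I -> R) (p : I -> qpath Q) :
  pa_diag k * pa_comb s p = pa_comb (fun i => k (qstart (p i)) * s i) p.
Proof.
rewrite [pa_comb s p]/pa_comb mulr_sumr.
by apply: eq_bigr => i _; apply: pa_diag_mul.
Qed.

Lemma pa_comb_mul_diag (I : finType) k (s : I -> R) (p : I -> qpath Q) :
  pa_comb s p * pa_diag k = pa_comb (fun i => s i * k (qend (p i))) p.
Proof.
rewrite [pa_comb s p]/pa_comb mulr_suml.
by apply: eq_bigr => i _; apply: pa_mul_diag.
Qed.

Lemma pa_diag1 : pa_diag (fun=> 1) = 1.
Proof. by []. Qed.

Lemma pmono_walk v (s : seq (arrow Q)) (vs : composable v s) :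
  pmono 1 (qvertex v) * \prod_(a <- s) pa_arrow R a = pmono 1 (exist _ (v, s) vs).
Proof.
elim: s v vs => [|a s IHs] v vs.
  by rewrite big_nil mulr1; congr pmono; apply: qpath_eq.
have /andP[/eqP av vs'] := vs; rewrite big_cons mulrA.
have va : qend (qvertex v) = qstart (qarrow a) by rewrite -av.
(* The trivial path is moved past the arrow, becoming the one at its target, where the induction
   hypothesis starts. *)
have {va} -> : pmono 1 (qvertex v) * pa_arrow R a =
    pa_arrow R a * pmono 1 (qvertex (tgt a)).
  have e : qend (qarrow a) = qstart (qvertex (tgt a)) by [].
  rewrite [LHS](pmono_mul _ _ va) [RHS](pmono_mul _ _ e).
  by congr pmono; apply: qpath_eq.
rewrite -mulrA [X in _ * X](IHs _ vs').
have e : qend (qarrow a) = qstart (exist _ (tgt a, s) vs' : qpath Q) by [].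
by rewrite [LHS](pmono_mul _ _ e) mulr1; congr pmono; apply: qpath_eq.
Qed.

Lemma pmono_prod c p : pmono c p =
  pa_diag (fun=> c) * (pmono 1 (qvertex (qstart p)) *
                       \prod_(a <- qarrows p) pa_arrow R a).
Proof.
rewrite (pmono_walk (valP p)) pa_diag_mul mulr1.
by congr pmono; apply: qpath_eq.
Qed.

Lemma pathalgE x : x = \sum_(p <- msupp x) pmono x@_p p.
Proof. exact: monalgE. Qed.

Lemma pa_deg0 d : pa_deg d (0 : pathalg R Q).
Proof. by move=> p; rewrite msupp0. Qed.

Lemma pa_degD d x y : pa_deg d x -> pa_deg d y -> pa_deg d (x + y).
Proof.
move=> xd yd p /(fsubsetP (msuppD_le _ _)); rewrite in_fsetU.
by case/orP=> [/xd|/yd].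
Qed.

Lemma pa_deg_pmono c p : pa_deg (size (qarrows p)) (pmono c p : pathalg R Q).
Proof. by move=> q /(fsubsetP msuppU_le); rewrite in_fset1 => /eqP ->. Qed.

Lemma pa_deg_sum d I (r : seq I) (F : I -> pathalg R Q) :
  (forall i, pa_deg d (F i)) -> pa_deg d (\sum_(i <- r) F i).
Proof.
by move=> Fd; elim/big_rec: _ => [|i x _]; [apply: pa_deg0 | apply: pa_degD].
Qed.

(** Lengths add under concatenation, and a product of non-composable paths is 0, which is
    homogeneous of every degree. *)
Lemma pa_degM d d' x y : pa_deg d x -> pa_deg d' y -> pa_deg (d + d') (x * y).
Proof.
move=> xd yd; rewrite [x]pathalgE [y]pathalgE mulr_suml big_seq.
elim/big_rec: _ => [|p z /xd pd]; first exact: pa_deg0.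
apply: pa_degD; rewrite mulr_sumr big_seq.
elim/big_rec: _ => {z} [|q z /yd qd]; first exact: pa_deg0.
apply: pa_degD; have [pq|/eqP pq] := eqVneq (qend p) (qstart q); last first.
  by rewrite pmono_mul_neq //; apply: pa_deg0.
by rewrite (pmono_mul _ _ pq) -pd -qd -size_cat; apply: pa_deg_pmono.
Qed.

Variables (B : pzRingType) (c : {rmorphism R -> B}).
Variables (E : vertex Q -> B) (X : arrow Q -> B).
Hypotheses (cC : forall r z, c r * z = z * c r)
  (E1 : \sum_v E v = 1)
  (EE : forall v, E v * E v = E v)
  (EE0 : forall v w, v != w -> E v * E w = 0)
  (EX : forall a, E (src a) * X a = X a)
  (XE : forall a, X a * E (tgt a) = X a).

(** The image of a walk. Only the idempotent at its start is written, because the arrows absorb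
    those at later vertices. *)
Let W (v : vertex Q) (s : seq (arrow Q)) : B := E v * \prod_(a <- s) X a.

Lemma walk_end_mul v s : composable v s -> W v s * E (walk_end v s) = W v s.
Proof.
elim: s v => [|a s IHs] v /=; first by rewrite /W big_nil mulr1 EE.
case/andP=> /eqP <- /IHs; rewrite /W big_cons /walk_end /= !mulrA EX => IH.
(* The idempotent at the target of [a] is reinserted in front of the tail to match the induction
   hypothesis. *)
by rewrite -XE -!mulrA; congr (_ * _); rewrite !mulrA.
Qed.

Definition pa_lift x : B :=
  \sum_(p <- msupp x) c x@_p * W (qstart p) (qarrows p).

Lemma pa_liftw (d : {fset qpath Q}) x : (msupp x `<=` d)%fset ->
  pa_lift x = \sum_(p <- d) c x@_p * W (qstart p) (qarrows p).
Proof.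
move=> le; rewrite /pa_lift (big_fset_incl _ le) // => p _ /mcoeff_outdom ->.
by rewrite rmorph0 mul0r.
Qed.

Lemma pa_liftD : {morph pa_lift : x y / x + y}.
Proof.
move=> x y.
rewrite (pa_liftw (fsubsetUl (msupp x) (msupp y))).
rewrite (pa_liftw (fsubsetUr (msupp x) (msupp y))).
rewrite (pa_liftw (msuppD_le x y)) -big_split /=.
by apply: eq_bigr => p _; rewrite mcoeffD rmorphD mulrDl.
Qed.

Lemma pa_lift_mono r p : pa_lift (pmono r p) = c r * W (qstart p) (qarrows p).
Proof. by rewrite (pa_liftw msuppU_le) big_seq_fset1 mcoeffUU. Qed.

Lemma pa_lift0 : pa_lift 0 = 0.
Proof. by apply: (addrI (pa_lift 0)); rewrite -pa_liftD !addr0. Qed.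

Lemma pa_liftM : {morph pa_lift : x y / x * y}.
Proof.
move=> x y; elim/pathalg_ind: x => [|r p|x x' IHx IHx'].
- by rewrite mul0r pa_lift0 mul0r.
- elim/pathalg_ind: y => [|s q|y y' IHy IHy'].
  + by rewrite mulr0 pa_lift0 mulr0.
  + apply: etrans (esym (f_equal2 *%R (pa_lift_mono r p) (pa_lift_mono s q))).
    (* Centrality of the image of [R] gathers both coefficients in front. *)
    have comm u w : c r * u * (c s * w) = c (r * s) * (u * w).
      by rewrite rmorphM -!mulrA; congr (_ * _); rewrite !mulrA cC.
    rewrite comm {comm}.
    have We := walk_end_mul (valP p : composable (qstart p) (qarrows p)).
    rewrite -[walk_end _ _]/(qend p) in We.
    have [pq|/eqP pq] := eqVneq (qend p) (qstart q).
      rewrite (pmono_mul _ _ pq) pa_lift_mono; congr (_ * _).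
      (* For composable paths the idempotent starting the second walk is the one absorbed by the end
         of the first. *)
      by rewrite [W (qstart q) _]/W -pq mulrA We /W -mulrA -big_cat.
    (* Otherwise the idempotents at the end of [p] and the start of [q] meet, and they are
       orthogonal. *)
    rewrite pmono_mul_neq // pa_lift0 -We [W (qstart q) _]/W !mulrA.
    by rewrite -[_ * E (qend p) * E _]mulrA EE0 ?mulr0 ?mul0r //; apply/eqP.
  + by rewrite pa_liftD [RHS]mulrDr -IHy -IHy' -pa_liftD mulrDr.
- by rewrite pa_liftD [RHS]mulrDl -IHx -IHx' -pa_liftD mulrDl.
Qed.

Lemma pathalg_lift :
  exists F : {rmorphism pathalg R Q -> B}, forall r p,
    F (pmono r p) = c r * (E (qstart p) * \prod_(a <- qarrows p) X a).
Proof.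
have [||F FE] := @rmorphism_exists _ _ pa_lift.
- exact/morphD_zmod_morphism/pa_liftD.
- split; last exact: pa_liftM.
  (* The unit is the sum of the trivial paths, whose images [E v] add up to 1. *)
  rewrite (big_morph _ pa_liftD pa_lift0) -E1; apply: eq_bigr => v _.
  by rewrite pa_lift_mono rmorph1 mul1r /W big_nil mulr1.
by exists F => r p; rewrite FE pa_lift_mono.
Qed.

End PathAlgebra.

(** * Morphisms between the tensor algebra and the path algebra of the doubled star *)

Section Star.
Variables (R : comPzRingType) (n : nat).

Local Notation Sn := {ffun 'I_n -> R}.
Local Notation DQ := (double_quiver (star n)).
Local Notation RQ := (pathalg R DQ).
Local Notation V := (bimM (@diag R n) * bimN (@diag R n))%type.
Local Notation T := (tensRS (@diag R n)).
Local Notation arrowl i := (qarrow (inl i : arrow DQ)).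
Local Notation arrowr i := (qarrow (inr i : arrow DQ)).

(** This views [R x S] as the ring of functions on the vertices, with [R] placed at the centre. *)
Definition star_coef (a : R * Sn) (v : vertex DQ) : R :=
  if v is Some i then a.2 i else a.1.

Definition star_base (a : R * Sn) : RQ := pa_diag (star_coef a).

Definition star_gen (m : V) : RQ :=
  pa_comb (m.1 : Sn) (fun i => arrowl i) + pa_comb (m.2 : Sn) (fun i => arrowr i).

Lemma star_base_zmod_morphism : zmod_morphism star_base.
Proof.
move=> a b; rewrite -[RHS]pa_combB; apply: eq_pa_comb => -[i|] //=.
by rewrite !ffunE.
Qed.

Lemma star_base_monoid_morphism : monoid_morphism star_base.
Proof.
split=> [|a b]; rewrite /star_base -?pa_diag1 ?pa_diag_mul_comb.
  by apply: eq_pa_comb => -[i|] //=; rewrite ffunE.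
by apply: eq_pa_comb => -[i|] //=; rewrite ffunE.
Qed.

Lemma star_genD : {morph star_gen : m m' / m + m'}.
Proof.
move=> m m'; rewrite /star_gen [RHS]addrACA.
by congr (_ + _); rewrite -[RHS]pa_combD; apply: eq_pa_comb => i; rewrite ffunE.
Qed.

(** Paths compose from left to right, so the left action must match the source: [a_i] starts at the
    centre, where [R] acts, and [a_i^*] at the outer vertex [i], where [S] acts. The targets match
    the right action in the same way. *)
Lemma star_genZ a m : star_gen (a *: m) = star_base a * star_gen m.
Proof.
rewrite /star_gen [RHS]mulrDr.
congr (_ + _); rewrite [RHS]pa_diag_mul_comb; apply: eq_pa_comb => i.
  by rewrite !ffunE.
by rewrite !ffunE.
Qed.

Lemma star_genM m a : star_gen (ract m a) = star_gen m * star_base a.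
Proof.
rewrite /star_gen [RHS]mulrDl.
congr (_ + _); rewrite [RHS]pa_comb_mul_diag; apply: eq_pa_comb => i.
  by rewrite !ffunE.
by rewrite !ffunE.
Qed.

Lemma star_lift : exists F : {rmorphism T -> RQ},
  (forall a, F (ta_base _ a) = star_base a) /\
  (forall m, F (ta_gen m) = star_gen m).
Proof.
have [b bE] := rmorphism_exists star_base_zmod_morphism star_base_monoid_morphism.
have [|a m|m a|F [Fb Fg]] := @tensalg_lift _ _ _ b star_gen.
- exact: star_genD.
- by rewrite bE star_genZ.
- by rewrite bE star_genM.
by exists F; split=> [a|m]; rewrite ?Fb ?bE ?Fg.
Qed.

(** These are the idempotents of [R x S] that correspond to the trivial paths. *)
Definition vertex_unit (v : vertex DQ) : R * Sn :=
  if v is Some i then (0, idem R i) else (1, 0).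

Definition arrow_gen (a : arrow DQ) : T :=
  match a with inl i => genM _ (idem R i) | inr i => genN _ (idem R i) end.

Lemma idemM (i j : 'I_n) : idem R i * idem R j = if i == j then idem R i else 0.
Proof.
apply/ffunP => k; rewrite !ffunE; case: (eqVneq i j) => [<-|ij].
  by rewrite ffunE; case: eqP => _; rewrite ?mulr1 ?mulr0.
by rewrite ffunE; case: (eqVneq i k) ij => [->|]; rewrite ?mul0r // => /negPf;
  rewrite eq_sym => ->; rewrite mulr0.
Qed.

Lemma vertex_unit_decomp (a : R * Sn) :
  \sum_v (star_coef a v, diag n (star_coef a v)) * vertex_unit v = a.
Proof.
rewrite (bigD1 None) //= (reindex_omap Some id) => [|[]] //=.
rewrite (eq_bigl xpredT) => [|i]; last by rewrite eqxx.
rewrite [LHS]surjective_pairing !raddfD !raddf_sum /= big1 => [|i _].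
  by rewrite mulr1 addr0 mulr0 add0r -idem_decomp; case: a.
by rewrite mulr0.
Qed.

Lemma star_unlift : exists G : {rmorphism RQ -> T}, forall r p,
  G (pmono r p) = ta_base _ (r, diag n r) *
    (ta_base _ (vertex_unit (qstart p)) * \prod_(a <- qarrows p) arrow_gen a).
Proof.
have cB : zmod_morphism (fun r => ta_base V (r, diag n r)).
  move=> r s; rewrite -raddfB; congr ta_base; congr (_, _); exact: raddfB.
have cM : monoid_morphism (fun r => ta_base V (r, diag n r)).
  split=> [|r s]; first by rewrite -[RHS](rmorph1 (ta_base V)); congr ta_base;
    congr (_, _); exact: rmorph1.
  rewrite -rmorphM; congr ta_base; congr (_, _); exact: rmorphM.
have [c cE] := rmorphism_exists cB cM.
have [r z||v|v w vw|a|a|G GE] := @pathalg_lift R DQ _ c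
  (fun v => ta_base V (vertex_unit v)) arrow_gen.
(* The diagonal copy of [R] is central because it acts identically on the two sides of [M] and of
   [N]. *)
- rewrite cE ta_base_central // => [a|[m m']]; first by rewrite mulrC.
  by congr (_, _); rewrite /GRing.scale /= /ract /=; apply: mulrC.
- rewrite -(raddf_sum (ta_base V)) -[RHS](rmorph1 (ta_base V)); congr ta_base.
  (* The unit is decomposed over the vertices, where all its coefficients are 1. *)
  rewrite -[RHS]vertex_unit_decomp; apply: eq_bigr => v _.
  have -> : star_coef 1 v = 1 by case: v => [i|] //=; rewrite ffunE.
  rewrite -[LHS]mul1r; congr (_ * _); congr (_, _); exact/esym/rmorph1.
- rewrite -rmorphM; congr ta_base; case: v => [i|]; congr (_, _);
  by rewrite /= ?idemM ?eqxx ?mulr1 ?mulr0.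
- rewrite -rmorphM -(raddf0 (ta_base V)); congr ta_base.
  case: v w vw => [i|] [j|] // vw; congr (_, _); rewrite ?mul0r ?mulr0 //.
  by rewrite idemM ifN.
- case: a => i; rewrite [LHS]ta_base_gen; congr ta_gen; congr (_, _);
    rewrite ?scaler0 //.
  + by rewrite /GRing.scale /= /bimM_scale /= rmorph1 mul1r.
  + by rewrite /GRing.scale /= /bimN_scale /= idemM eqxx.
- case: a => i; rewrite [LHS]ta_gen_base; congr ta_gen; congr (_, _).
  + by rewrite /ract /= /bimM_ract /= idemM eqxx.
  + exact: mul0r.
  + exact: mul0r.
  + by rewrite /ract /= /bimN_ract /= rmorph1 mulr1.
by exists G => r p; rewrite GE cE.
Qed.

Lemma genM_sum I (r : seq I) (F : I -> Sn) :
  genM (@diag R n) (\sum_(i <- r) F i) = \sum_(i <- r) genM (@diag R n) (F i).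
Proof.
apply: (big_morph (genM (@diag R n))) => [s t|].
  by apply: etrans _ (ta_genD _ _); congr ta_gen; congr (_, _); rewrite addr0.
exact: ta_gen0.
Qed.

Lemma genN_sum I (r : seq I) (F : I -> Sn) :
  genN (@diag R n) (\sum_(i <- r) F i) = \sum_(i <- r) genN (@diag R n) (F i).
Proof.
apply: (big_morph (genN (@diag R n))) => [s t|].
  by apply: etrans _ (ta_genD _ _); congr ta_gen; congr (_, _); rewrite addr0.
exact: ta_gen0.
Qed.

Lemma star_gen_l (s : Sn) : star_gen (s, 0) = pa_comb s (fun i => arrowl i).
Proof.
rewrite /star_gen [X in _ + X](_ : _ = 0) ?addr0 //.
by rewrite [LHS]big1 // => i _; rewrite ffunE [LHS]pmono0.
Qed.

Lemma star_gen_r (s : Sn) : star_gen (0, s) = pa_comb s (fun i => arrowr i).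
Proof.
rewrite /star_gen [X in X + _](_ : _ = 0) ?add0r //.
by rewrite [LHS]big1 // => i _; rewrite ffunE [LHS]pmono0.
Qed.

Lemma pa_comb_idem (i : 'I_n) (p : 'I_n -> qpath DQ) :
  pa_comb (idem R i : Sn) p = pmono 1 (p i).
Proof. by rewrite -pa_comb_delta; apply: eq_pa_comb => j; rewrite ffunE. Qed.

(** * The two morphisms are mutually inverse and preserve degrees *)

Variables (F : {rmorphism T -> RQ}) (G : {rmorphism RQ -> T}).
Hypotheses (Fbase : forall a, F (ta_base _ a) = star_base a)
  (Fgen : forall m, F (ta_gen m) = star_gen m)
  (Gmono : forall r p, G (pmono r p) = ta_base _ (r, diag n r) *
    (ta_base _ (vertex_unit (qstart p)) * \prod_(a <- qarrows p) arrow_gen a)).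

Lemma star_liftK : cancel F G.
Proof.
have Gl (s : Sn) : G (pa_comb s (fun i => arrowl i)) = genM _ s.
  rewrite raddf_sum [in RHS](idem_decomp s) genM_sum; apply: eq_bigr => i _.
  rewrite [LHS]Gmono big_seq1 [X in _ * X]ta_base_gen [LHS]ta_base_gen.
  congr ta_gen; congr (_, _); last first.
    by apply: etrans (mulr0 _); congr (_ * _); apply: mulr0.
  (* The source of [a_i] is the centre, whose idempotent acts on [M] as [diag n 1]. *)
  change (diag n (s i) * (diag n 1 * idem R i) = diag n (s i) * idem R i).
  by rewrite rmorph1 mul1r.
have Gr (s : Sn) : G (pa_comb s (fun i => arrowr i)) = genN _ s.
  rewrite raddf_sum [in RHS](idem_decomp s) genN_sum; apply: eq_bigr => i _.
  rewrite [LHS]Gmono big_seq1 [X in _ * X]ta_base_gen [LHS]ta_base_gen.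
  congr ta_gen; congr (_, _).
    by apply: etrans (mulr0 _); congr (_ * _); apply: mulr0.
  (* The source of [a_i^*] is the outer vertex [i], whose idempotent is absorbed by idempotence. *)
  change (diag n (s i) * (idem R i * idem R i) = diag n (s i) * idem R i).
  by rewrite idemM eqxx.
elim/tensalg_ind => [a|v x IHx|x y IHx IHy].
- rewrite Fbase raddf_sum -[in RHS](vertex_unit_decomp a) raddf_sum.
  by apply: eq_bigr => v _; rewrite [LHS]Gmono big_nil mulr1 -rmorphM.
- rewrite rmorphM Fgen rmorphM IHx; congr (_ * _).
  rewrite raddfD [X in X + _]Gl [X in _ + X]Gr.
  apply: etrans (esym (ta_genD _ _)) _.
  by case: v => m m'; congr ta_gen; congr (_, _); rewrite ?addr0 ?add0r.
- by rewrite [F _]rmorphD [LHS]rmorphD IHx IHy.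
Qed.

Lemma star_unliftK : cancel G F.
Proof.
suff FG r p : F (G (pmono r p)) = pmono r p.
  move=> x; rewrite [x]pathalgE [G _]raddf_sum [LHS]raddf_sum.
  by apply: eq_bigr => p _; apply: FG.
rewrite Gmono.
(* Both sides are now a scalar times a trivial path times a product of arrows, and are compared
   factor by factor. *)
rewrite [RHS]pmono_prod.
rewrite [LHS]rmorphM; congr (_ * _).
  by rewrite [LHS]Fbase; apply: eq_pa_comb => -[i|] //=; rewrite ffunE.
rewrite [LHS]rmorphM; congr (_ * _).
  rewrite [LHS]Fbase -[RHS]pa_comb_delta; apply: eq_pa_comb => v.
  by case: (qstart p) v => [i|] [j|] //=; rewrite ffunE.
rewrite rmorph_prod; apply: eq_bigr => -[i|i] _.
  by rewrite [LHS]Fgen [LHS]star_gen_l [LHS]pa_comb_idem.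
by rewrite [LHS]Fgen [LHS]star_gen_r [LHS]pa_comb_idem.
Qed.

Lemma star_lift_deg d x : ta_deg d x -> pa_deg d (F x).
Proof.
apply: (ta_deg_ind (P := fun d x => pa_deg d (F x)))
  => {d x} [d|a|d v x Fx|d x y Fx Fy].
- by rewrite raddf0; apply: pa_deg0.
- by rewrite Fbase; apply: pa_deg_sum => v; apply: pa_deg_pmono.
- rewrite rmorphM -add1n; apply: pa_degM => //; rewrite Fgen.
  by apply: pa_degD; apply: pa_deg_sum => i; apply: pa_deg_pmono.
- by rewrite raddfD; apply: pa_degD.
Qed.

(** Scalars and vertex idempotents have tensor degree 0, and each arrow contributes exactly one
    generator. *)
Lemma star_unlift_deg d x : pa_deg d x -> ta_deg d (G x).
Proof.
move=> xd; rewrite [x]pathalgE raddf_sum big_seq.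
elim/big_rec: _ => [|p z /xd <-]; first exact: ta_deg0.
apply: ta_degD => //; rewrite [X in ta_deg _ X]Gmono; do 2!apply: ta_deg_base_mul.
elim: (qarrows p) => [|[i|i] s IHs].
- by rewrite big_nil -(rmorph1 (ta_base V)); apply: ta_deg_base.
- by rewrite big_cons; apply: ta_deg_gen_mul.
- by rewrite big_cons; apply: ta_deg_gen_mul.
Qed.

(** * Comparison of the defining relations *)

(** The arrow [a_i] ends at the outer vertex [i] and [a_j^*] starts at [j], so the cross terms
    vanish. *)
Lemma pa_comb_lr : pa_comb (fun=> 1) (fun i => arrowl i) *
  pa_comb (fun=> 1) (fun i => arrowr i) = \sum_i star_arrow R i * star_arrow' R i.
Proof.
rewrite [LHS]mulr_suml; apply: eq_bigr => i _.
rewrite [LHS]mulr_sumr [LHS](bigD1 i) //= [X in _ + X]big1 ?addr0 // => j ji.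
by apply: pmono_mul_neq => -[ij]; rewrite ij eqxx in ji.
Qed.

(** The path [a_i^* a_j] through the centre exists for all [i] and [j], so here cross terms can
    disappear only through their coefficients. *)
Definition outer_path (i j : 'I_n) : qpath DQ :=
  qcat (erefl : qend (arrowr i) = qstart (arrowl j)).

Lemma pa_comb_rl (s t : Sn) :
  pa_comb s (fun i => arrowr i) * pa_comb t (fun i => arrowl i) =
  \sum_i \sum_j pmono (s i * t j) (outer_path i j).
Proof.
rewrite [LHS]mulr_suml; apply: eq_bigr => i _.
by rewrite [LHS]mulr_sumr; apply: eq_bigr => j _; apply: pmono_mul.
Qed.

Lemma pmono_sum I (r : seq I) (c : I -> R) (p : qpath DQ) :
  pmono (\sum_(i <- r) c i) p = \sum_(i <- r) pmono (c i) p :> RQ.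
Proof.
exact: (big_morph (fun d => pmono d p) (@pmonoD R DQ p) (@pmono0 R DQ p)).
Qed.

Variables (l : Sn -> R) (e g : 'I_n -> Sn).
Hypothesis frob : frobenius_data (@diag R n) l e g.

(** The sums are the coordinates of the Casimir element on pairs of idempotents. A one-sided inverse
    of a square matrix over a commutative ring is two-sided; this turns duality of the bases into
    [u i * c j i = (i == j)%:R], which makes [u] a unit with inverse the diagonal of [c]. *)
Lemma casimir_diagonal : exists2 u : Sn * Sn, u.1 * u.2 = 1 &
  forall i j, \sum_k e k i * g k j = if i == j then u.2 i else 0.
Proof.
have [u lE] : exists u : Sn, forall s, l s = \sum_i s i * u i.
  exists [ffun i => l (idem R i)] => s.
  rewrite [in LHS](idem_decomp s) (linear_form_sum _ _ (fd_linear frob)).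
  by apply: eq_bigr => i _; rewrite ffunE.
pose c i j := \sum_k e k i * g k j.
have uc i j : u i * c j i = (i == j)%:R.
  pose M := \matrix_(k, i) e k i; pose N := \matrix_(i, k) (u i * g k i).
  (* Duality of the bases reads M *m N = 1; c comes from N *m M = 1. *)
  have /mulmx1C/matrixP/(_ i j) : M *m N = 1%:M.
    apply/matrixP => k m; rewrite !mxE -(fd_dual frob) lE; apply: eq_bigr => a _.
    by rewrite !mxE ffunE mulrA mulrAC.
  rewrite !mxE => <-; rewrite mulr_sumr; apply: eq_bigr => k _.
  by rewrite !mxE -mulrA [g k i * _]mulrC.
exists (u, [ffun i => c i i]) => [|i j] /=.
  by apply/ffunP => i; rewrite !ffunE uc eqxx.
rewrite -/(c i j); case: eqVneq => [<-|ij]; first by rewrite ffunE.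
(* Off the diagonal [u j * c i j] is 0, and [u j] is invertible, so [c i j] is 0. *)
have uj : u j * c j j = 1 by rewrite uc eqxx.
by rewrite -[LHS]mul1r -uj mulrAC uc eq_sym (negPf ij) mul0r.
Qed.

Lemma Pi_rel_central :
  F (genM _ 1 * genN _ 1) = \sum_i star_arrow R i * star_arrow' R i.
Proof.
rewrite -[RHS]pa_comb_lr [LHS]rmorphM.
congr (_ * _); rewrite [LHS]Fgen.
  by rewrite [LHS]star_gen_l; apply: eq_pa_comb => i; rewrite ffunE.
by rewrite [LHS]star_gen_r; apply: eq_pa_comb => i; rewrite ffunE.
Qed.

Lemma star_outer : \sum_i star_arrow' R i * star_arrow R i =
  \sum_i pmono 1 (outer_path i i).
Proof.
apply: eq_bigr => i _.
rewrite [LHS](pmono_mul _ _ (erefl : qend (arrowr i) = qstart (arrowl i))).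
by rewrite mulr1.
Qed.

(** The loops [a_i^* a_i] start at distinct outer vertices, so an element of [S] rescales each of
    them independently. *)
Lemma star_base_outer (w : Sn) :
  star_base (0, w) * \sum_i star_arrow' R i * star_arrow R i =
  \sum_i pmono (w i) (outer_path i i).
Proof.
rewrite star_outer [LHS]mulr_sumr; apply: eq_bigr => i _.
by rewrite [LHS]pa_diag_mul mulr1.
Qed.

Lemma Pi_rel_outer (w : Sn) :
  (forall i j, \sum_k e k i * g k j = if i == j then w i else 0) ->
  F (\sum_i genN _ (e i) * genM _ (g i)) =
  star_base (0, w) * \sum_i star_arrow' R i * star_arrow R i.
Proof.
move=> cas; rewrite star_base_outer.
transitivity (\sum_k \sum_i \sum_j pmono (e k i * g k j) (outer_path i j) : RQ).
  rewrite rmorph_sum; apply: eq_bigr => k _.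
  rewrite -[RHS]pa_comb_rl [LHS]rmorphM; congr (_ * _); rewrite [LHS]Fgen.
    exact: star_gen_r.
  exact: star_gen_l.
(* With the sum over [k] innermost, the coefficient of [outer_path i j] is a Casimir coordinate,
   zero unless [i] equals [j]. *)
rewrite [LHS]exchange_big; apply: eq_bigr => i _.
rewrite [LHS]exchange_big [LHS](bigD1 i) //= [X in _ + X]big1 => [|j ji].
  by rewrite addr0 -[LHS]pmono_sum cas eqxx.
by rewrite -[LHS]pmono_sum cas eq_sym (negPf ji) [LHS]pmono0.
Qed.

Lemma star_lift_rel x : Pi_rel e g x -> ideal_gen (@preproj_rel R n) (F x).
Proof.
case: casimir_diagonal => -[u w] _ cas [] ->.
  by rewrite Pi_rel_central; apply: ideal_gen_in; left.
by rewrite (Pi_rel_outer cas); apply: ideal_genMl; apply: ideal_gen_in; right.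
Qed.

Lemma star_unlift_rel x : preproj_rel x -> ideal_gen (Pi_rel e g) (G x).
Proof.
case: casimir_diagonal => -[u w] /= uw cas [] ->.
  by rewrite -Pi_rel_central star_liftK; apply: ideal_gen_in; left.
(* Multiplying the Casimir relator by [u] cancels the factor [w], so the preprojective relator is
   the image of an element of the ideal of [Pi_rel]. *)
have -> : \sum_i star_arrow' R i * star_arrow R i =
    F (ta_base _ (0, u) * \sum_i genN _ (e i) * genM _ (g i)).
  rewrite [RHS]rmorphM Fbase (Pi_rel_outer cas) [RHS]mulrA.
  rewrite -(star_base_monoid_morphism.2 (0, u) (0, w)).
  (* The product [(0, 1)] is not the unit of [R x S], but it acts as the identity on loops at outer
     vertices. *)
  rewrite [X in star_base X](_ : _ = (0, 1)); last by congr (_, _); rewrite ?mulr0.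
  rewrite star_base_outer star_outer; apply: eq_bigr => i _.
  by rewrite ffunE.
by rewrite star_liftK; apply: ideal_genMl; apply: ideal_gen_in; right.
Qed.

End Star.

Theorem lemma1p5 (R : comPzRingType) (n : nat)
    (l : {ffun 'I_n -> R} -> R) (e g : 'I_n -> {ffun 'I_n -> R})
    (noethR : noetherian R) (n_ge1 : (1 <= n)%N)
    (frob : frobenius_data (@diag R n) l e g) :
  exists phi : {rmorphism Pi (@diag R n) e g -> preproj R n},
    [/\ bijective phi,
        forall r : R, phi (Pi_scalar (@diag R n) e g r) = preproj_scalar n r
      & forall (d : nat) (x : Pi (@diag R n) e g),
          Pi_deg d x <-> preproj_deg d (phi x)].
Proof.
have [F [Fbase Fgen]] := star_lift R n.
have [G Gmono] := star_unlift R n.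
have FK := star_liftK Fbase Fgen Gmono.
have GK := star_unliftK Fbase Fgen Gmono.
(* Each of [F] and [G] sends relators into the other ideal, so both descend, and they remain inverse
   on classes. *)
have [phi phiE] := ringquot_map (star_lift_rel Fgen frob).
have [psi psiE] := ringquot_map (star_unlift_rel Fbase Fgen Gmono frob).
have phiK : cancel phi psi by elim/rq_piP=> x; rewrite phiE psiE FK.
have psiK : cancel psi phi by elim/rq_piP=> x; rewrite psiE phiE GK.
exists phi; split=> [|r|d x]; first by exists psi.
  apply: etrans (phiE _) _; apply: (f_equal (rq_pi _)); apply: etrans (Fbase _) _.
  by apply: eq_pa_comb => -[i|] //=; rewrite ffunE.
split=> [[t td ->]|[t td xt]].
  by exists (F t); [apply: star_lift_deg td | apply: phiE].
(* The class of [G t] is the image under [psi] of the class of [t], hence [x] itself. *)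
exists (G t); first exact: star_unlift_deg td.
by rewrite -[x]phiK xt; apply: psiE.
Qed.
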